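(* (1) If $\Phi$ is a (not necessarily linear) $2$-positive map between unital $C^*$-algebras, then $\Phi$ is a Lieb map. (2) Let $\mathscr{A}$ be a von Neumann algebra and $\mathscr{B}$ be a unital $C^*$-algebra. Let $\Phi:\mathscr{A}\to\mathscr{B}$ be a (not necessarily linear) $*$-map. Then $\Phi$ is a Lieb map if and only if $\Phi$ is $2$-positive.
   Context: Maps between $C^*$-algebras are arbitrary functions; neither linearity nor continuity is assumed. $\mathscr{A}_+$ denotes the set of positive elements of $\mathscr{A}$. A map $\Phi:\mathscr{A}\to\mathscr{B}$ is a $*$-map if $\Phi(A^* )=\Phi(A)^*$ for all $A$. It is positive if it sends positive elements to positive elements, and $n$-positive if the entrywise map $\Phi_n:M_n(\mathscr{A})\to M_n(\mathscr{B})$, $\Phi_n([a_{ij}])=[\Phi(a_{ij})]$, is positive. A map $\Phi:\mathscr{A}\to\mathscr{B}$ between $C^*$-algebras is called a Lieb map if it satisfies: (Monotonicity) $\Phi(A)\geq\Phi(B)$ whenever $A\geq B$ with $B\in\mathscr{A}_+$; (Cauchy--Schwarz) $\begin{bmatrix}\Phi(A^*A)&\Phi(A^*B)\\ \Phi(A^*B)^*&\Phi(B^*B)\end{bmatrix}\geq 0$ in $M_2(\mathscr{B})$ for every $A,B\in\mathscr{A}$. A von Neumann algebra is a unital $*$-subalgebra of $\mathbb{B}(\mathscr{H})$, for a complex Hilbert space $\mathscr{H}$, closed in the strong operator topology. *)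

(* Defs.v *)
From HB Require Import structures.
From mathcomp Require Import all_boot all_order all_algebra.
From mathcomp Require Import sesquilinear complex.
From mathcomp Require Import boolp classical_sets functions reals.
From mathcomp Require Import topology normedtype.

Set Implicit Arguments.
Unset Strict Implicit.
Unset Printing Implicit Defensive.

Import Order.TTheory GRing.Theory Num.Theory.
Import numFieldNormedType.Exports.

Local Open Scope classical_set_scope.
Local Open Scope ring_scope.
Local Open Scope complex_scope.

(* Unital complex *-algebras.  The library's [algType] imposes 1 != 0, whereas
   the zero algebra (e.g. the operators on the zero Hilbert space) has to be
   allowed; since no library structure combines [pzRingType] and [lmodType],
   the product is part of the mixin and the ring structure is derived. *)
HB.mixin Record Lmodule_isStarAlgebra (R : realType) A
    of GRing.Lmodule R[i] A := {
  amul : A -> A -> A;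
  aone : A;
  star : A -> A;
  amulA : associative amul;
  amul1r : left_id aone amul;
  amulr1 : right_id aone amul;
  amulDl : left_distributive amul +%R;
  amulDr : right_distributive amul +%R;
  ascaleAl : forall (l : R[i]) (a b : A), l *: amul a b = amul (l *: a) b;
  ascaleAr : forall (l : R[i]) (a b : A), l *: amul a b = amul a (l *: b);
  starD : forall a b : A, star (a + b) = star a + star b;
  starZ : forall (l : R[i]) (a : A), star (l *: a) = Num.conj l *: star a;
  starM : forall a b : A, star (amul a b) = amul (star b) (star a);
  starK : involutive star
}.

#[short(type="starAlgType")]
HB.structure Definition StarAlgebra (R : realType) :=
  {A of GRing.Lmodule R[i] A & Lmodule_isStarAlgebra R A}.

HB.instance Definition _ (R : realType) (A : starAlgType R) :=
  GRing.Zmodule_isPzRing.Build (StarAlgebra.sort A)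
    amulA amul1r amulr1 amulDl amulDr.

(* Unital C*-algebras.  As everywhere in the library, the norm of a normed
   module over R[i] takes its values in R[i] (in fact in its nonnegative real
   elements). *)
HB.mixin Record CompleteStarAlgebra_isCStarAlgebra (R : realType) A
    of StarAlgebra R A & CompleteNormedModule R[i] A := {
  cstar_normM : forall a b : A, `|amul a b| <= `|a| * `|b|;
  cstar_identity : forall a : A, `|amul (star a) a| = `|a| ^+ 2
}.

#[short(type="cstarAlgType")]
HB.structure Definition CStarAlgebra (R : realType) :=
  {A of StarAlgebra R A & CompleteNormedModule R[i] A &
        CompleteStarAlgebra_isCStarAlgebra R A}.

HB.instance Definition _ (R : realType) (A : cstarAlgType R) :=
  GRing.PzRing.copy (CStarAlgebra.sort A) (StarAlgebra.sort A).

HB.instance Definition _ (R : realType) (A : cstarAlgType R) :=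
  GRing.PzRing.copy (CStarAlgebra.sort A) (StarAlgebra.sort A).

Section Positivity.
Variables (R : realType) (A : starAlgType R).

Definition invertible (a : A) : Prop := exists b : A, a * b = 1 /\ b * a = 1.

Definition spectrum (a : A) : set R[i] := [set l | ~ invertible (a - l *: (1 : A))].

(* In R[i], 0 <= l means that l is real and nonnegative. *)
Definition positive_elt (a : A) : Prop :=
  star a = a /\ forall l : R[i], spectrum a l -> 0 <= l.

End Positivity.

(* M_n(A) as a *-algebra.  An alias of 'M[A]_n, because the latter is equipped
   by the library with scalars in A rather than in R[i]. *)
Definition matalg (R : realType) (A : starAlgType R) (n : nat) : Type :=
  'M[A]_n.

Section MatrixAlgebra.
Variables (R : realType) (A : starAlgType R) (n : nat).
Local Notation Mn := (matalg A n).

HB.instance Definition _ := GRing.Zmodule.on Mn.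

Definition matalg_scale (l : R[i]) (X : Mn) : Mn := \matrix_(i, j) (l *: X i j).
Definition matalg_mul (X Y : Mn) : Mn := (X : 'M[A]_n) *m (Y : 'M[A]_n).
Definition matalg_one : Mn := (1%:M : 'M[A]_n).
Definition matalg_star (X : Mn) : Mn := \matrix_(i, j) star (X j i).

Fact matalg_scaleA l m X :
  matalg_scale l (matalg_scale m X) = matalg_scale (l * m) X.
Proof. by apply/matrixP => i j; rewrite !mxE scalerA. Qed.
Fact matalg_scale1 : left_id 1 matalg_scale.
Proof. by move=> X; apply/matrixP => i j; rewrite !mxE scale1r. Qed.
Fact matalg_scaleDr : right_distributive matalg_scale +%R.
Proof. by move=> l X Y; apply/matrixP => i j; rewrite !mxE scalerDr. Qed.
Fact matalg_scaleDl X : {morph matalg_scale^~ X : l m / l + m}.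
Proof. by move=> l m; apply/matrixP => i j; rewrite !mxE scalerDl. Qed.

HB.instance Definition _ := GRing.Zmodule_isLmodule.Build R[i] Mn
  matalg_scaleA matalg_scale1 matalg_scaleDr matalg_scaleDl.

Fact matalg_mulA : associative matalg_mul.
Proof. exact: mulmxA. Qed.
Fact matalg_mul1r : left_id matalg_one matalg_mul.
Proof. exact: mul1mx. Qed.
Fact matalg_mulr1 : right_id matalg_one matalg_mul.
Proof. exact: mulmx1. Qed.
Fact matalg_mulDl : left_distributive matalg_mul +%R.
Proof. exact: mulmxDl. Qed.
Fact matalg_mulDr : right_distributive matalg_mul +%R.
Proof. exact: mulmxDr. Qed.
Fact matalg_scaleAl (l : R[i]) (X Y : Mn) :
  l *: matalg_mul X Y = matalg_mul (l *: X) Y.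
Proof.
apply/matrixP => i j; rewrite !mxE scaler_sumr; apply: eq_bigr => k _.
by rewrite mxE; exact: ascaleAl.
Qed.
Fact matalg_scaleAr (l : R[i]) (X Y : Mn) :
  l *: matalg_mul X Y = matalg_mul X (l *: Y).
Proof.
apply/matrixP => i j; rewrite !mxE scaler_sumr; apply: eq_bigr => k _.
by rewrite mxE; exact: ascaleAr.
Qed.
Fact matalg_starD (X Y : Mn) : matalg_star (X + Y) = matalg_star X + matalg_star Y.
Proof. by apply/matrixP => i j; rewrite !mxE starD. Qed.
Fact matalg_starZ (l : R[i]) (X : Mn) :
  matalg_star (l *: X) = Num.conj l *: matalg_star X.
Proof. by apply/matrixP => i j; rewrite !mxE starZ. Qed.
Fact matalg_starM (X Y : Mn) :
  matalg_star (matalg_mul X Y) = matalg_mul (matalg_star Y) (matalg_star X).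
Proof.
have star0 : star (0 : A) = 0 by apply: (addrI (star 0)); rewrite -starD !addr0.
apply/matrixP => i j; rewrite !mxE (big_morph _ (@starD R A) star0).
by apply: eq_bigr => k _; rewrite !mxE; exact: starM.
Qed.
Fact matalg_starK : involutive matalg_star.
Proof. by move=> X; apply/matrixP => i j; rewrite !mxE starK. Qed.

HB.instance Definition _ := Lmodule_isStarAlgebra.Build R Mn
  matalg_mulA matalg_mul1r matalg_mulr1 matalg_mulDl matalg_mulDr
  matalg_scaleAl matalg_scaleAr matalg_starD matalg_starZ matalg_starM
  matalg_starK.

End MatrixAlgebra.

Section Maps.
Variables (R : realType) (A B : starAlgType R).
Implicit Type Phi : A -> B.

Definition star_map Phi : Prop := forall a, Phi (star a) = star (Phi a).

Definition positive_map Phi : Prop :=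
  forall a, positive_elt a -> positive_elt (Phi a).

Definition block2 (a b c d : A) : matalg A 2 :=
  \matrix_(i < 2, j < 2)
    if i == 0 then (if j == 0 then a else b) else (if j == 0 then c else d).

End Maps.

Definition ampliation (R : realType) (A B : starAlgType R) (n : nat)
  (Phi : A -> B) (X : matalg A n) : matalg B n := map_mx Phi X.

Definition n_positive (R : realType) (A B : starAlgType R) (n : nat)
  (Phi : A -> B) : Prop := positive_map (@ampliation R A B n Phi).

Definition Lieb_map (R : realType) (A B : starAlgType R) (Phi : A -> B) : Prop :=
  (forall a b : A, positive_elt b -> positive_elt (a - b) ->
     positive_elt (Phi a - Phi b)) /\
  (forall a b : A,
     positive_elt (block2 (Phi (star a * a))        (Phi (star a * b))
                          (star (Phi (star a * b))) (Phi (star b * b)))).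

HB.mixin Record CompleteNormedModule_isHilbert (R : realType) H
    of CompleteNormedModule R[i] H := {
  inner : {dot H for (@Num.conj R[i])};
  inner_norm : forall x : H, inner x x = `|x| ^+ 2
}.

#[short(type="hilbertType")]
HB.structure Definition Hilbert (R : realType) :=
  {H of CompleteNormedModule R[i] H & CompleteNormedModule_isHilbert R H}.

Definition bounded_operator (R : realType) (H : hilbertType R) (T : H -> H) :
  Prop := linear T /\ continuous T.

Definition adjoint (R : realType) (H : hilbertType R) (T S : H -> H) : Prop :=
  forall x y : H, inner (T x) y = inner x (S y).

(* Unital *-subalgebras of B(H) closed in the strong operator topology, i.e. the
   topology induced on the bounded operators by pointwise convergence on H -> H.
   On a Hilbert space every bounded operator has exactly one adjoint, so
   [vn_adjoint] says that the set contains the adjoint of each of its elements. *)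
Record vonNeumannAlg (R : realType) (H : hilbertType R) := VonNeumannAlg {
  vn_set : set (H -> H);
  vn_bounded : forall T, vn_set T -> bounded_operator T;
  vn_id : vn_set idfun;
  vn_add : forall S T, vn_set S -> vn_set T -> vn_set (S + T);
  vn_scale : forall (l : R[i]) T, vn_set T -> vn_set (l *: T);
  vn_comp : forall S T, vn_set S -> vn_set T -> vn_set (S \o T);
  vn_adjoint : forall T, vn_set T -> exists2 S, vn_set S & adjoint T S;
  vn_closed : forall T, bounded_operator T ->
    closure (vn_set : set {ptws H -> H}) T -> vn_set T
}.

Definition vn_carrier (R : realType) (H : hilbertType R)
  (M : vonNeumannAlg H) : Type := set_type (vn_set M).

Lemma adjoint_unique (R : realType) (H : hilbertType R) (T S S' : H -> H) :
  adjoint T S -> adjoint T S' -> S = S'.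
Proof.
move=> TS TS'; apply/funext => y; apply/eqP.
rewrite -subr_eq0 -normr_eq0 -sqrf_eq0 -inner_norm linearBr /=.
by rewrite -TS -TS' subrr.
Qed.

Lemma inner_conj (R : realType) (H : hilbertType R) (x y : H) :
  inner x y = Num.conj (inner y x).
Proof. by rewrite [LHS](hermC (@inner R H)) expr0 mul1r. Qed.

Lemma adjoint_sym (R : realType) (H : hilbertType R) (T S : H -> H) :
  adjoint T S -> adjoint S T.
Proof. by move=> TS x y; rewrite inner_conj -TS -inner_conj. Qed.

(* The *-algebra carried by M: composition is the product, and star T is the
   unique operator adjoint to T. *)
Section VonNeumannStarAlgebra.
Variables (R : realType) (H : hilbertType R) (M : vonNeumannAlg H).
Local Notation W := (vn_carrier M).

HB.instance Definition _ := Choice.on W.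

Let mk (T : H -> H) (MT : vn_set M T) : W := exist _ T (mem_set MT).

Let vn_mem (T : W) : vn_set M (sval T).
Proof. exact: set_mem (svalP T). Qed.

Let vn_inj (S T : W) : sval S =1 sval T -> S = T.
Proof. by move=> /funext; exact: val_inj. Qed.

Let vn_linear (T : W) : linear (sval T).
Proof. by have [] := vn_bounded (vn_mem T). Qed.

Let vn_zero_mem : vn_set M 0.
Proof. by rewrite -(scale0r (idfun : H -> H)); exact/vn_scale/vn_id. Qed.

Let vn_opp_mem (T : W) : vn_set M (- sval T).
Proof. by rewrite -scaleN1r; exact/vn_scale/vn_mem. Qed.

Definition vn_zero : W := mk vn_zero_mem.
Definition vn_oppf (T : W) : W := mk (vn_opp_mem T).
Definition vn_addf (S T : W) : W := mk (vn_add (vn_mem S) (vn_mem T)).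
Definition vn_scalef (l : R[i]) (T : W) : W := mk (vn_scale l (vn_mem T)).
Definition vn_mulf (S T : W) : W := mk (vn_comp (vn_mem S) (vn_mem T)).
Definition vn_onef : W := mk (vn_id M).

Fact vn_star_subproof (T : W) : exists S : W, adjoint (sval T) (sval S).
Proof. by have [S MS TS] := vn_adjoint (vn_mem T); exists (mk MS). Qed.

Definition vn_starf (T : W) : W := projT1 (cid (vn_star_subproof T)).

Lemma vn_starfP (T : W) : adjoint (sval T) (sval (vn_starf T)).
Proof. by rewrite /vn_starf; case: cid. Qed.

Fact vn_addA : associative vn_addf.
Proof. by move=> S T U; apply: vn_inj => x /=; exact: addrA. Qed.
Fact vn_addC : commutative vn_addf.
Proof. by move=> S T; apply: vn_inj => x /=; exact: addrC. Qed.
Fact vn_add0 : left_id vn_zero vn_addf.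
Proof. by move=> T; apply: vn_inj => x /=; exact: add0r. Qed.
Fact vn_addN : left_inverse vn_zero vn_oppf vn_addf.
Proof. by move=> T; apply: vn_inj => x /=; exact: addNr. Qed.

HB.instance Definition _ :=
  GRing.isZmodule.Build W vn_addA vn_addC vn_add0 vn_addN.

Fact vn_scaleA l m T : vn_scalef l (vn_scalef m T) = vn_scalef (l * m) T.
Proof. by apply: vn_inj => x /=; exact: scalerA. Qed.
Fact vn_scale1 : left_id 1 vn_scalef.
Proof. by move=> T; apply: vn_inj => x /=; exact: scale1r. Qed.
Fact vn_scaleDr : right_distributive vn_scalef +%R.
Proof. by move=> l S T; apply: vn_inj => x /=; exact: scalerDr. Qed.
Fact vn_scaleDl T : {morph vn_scalef^~ T : l m / l + m}.
Proof. by move=> l m; apply: vn_inj => x /=; exact: scalerDl. Qed.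

HB.instance Definition _ := GRing.Zmodule_isLmodule.Build R[i] W
  vn_scaleA vn_scale1 vn_scaleDr vn_scaleDl.

Let vnD (T : W) x y : sval T (x + y) = sval T x + sval T y.
Proof. by have := vn_linear T 1 x y; rewrite !scale1r. Qed.
Let vnZ (T : W) l x : sval T (l *: x) = l *: sval T x.
Proof.
have T0 : sval T 0 = 0 by apply: (addrI (sval T 0)); rewrite -vnD !addr0.
by have := vn_linear T l x 0; rewrite T0 !addr0.
Qed.

Fact vn_mulA : associative vn_mulf.
Proof. by move=> S T U; apply: vn_inj. Qed.
Fact vn_mul1r : left_id vn_onef vn_mulf.
Proof. by move=> T; apply: vn_inj. Qed.
Fact vn_mulr1 : right_id vn_onef vn_mulf.
Proof. by move=> T; apply: vn_inj. Qed.
Fact vn_mulDl : left_distributive vn_mulf +%R.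
Proof. by move=> S T U; apply: vn_inj. Qed.
Fact vn_mulDr : right_distributive vn_mulf +%R.
Proof. by move=> S T U; apply: vn_inj => x /=; exact: vnD. Qed.
Fact vn_scaleAl (l : R[i]) (S T : W) : l *: vn_mulf S T = vn_mulf (l *: S) T.
Proof. exact: vn_inj. Qed.
Fact vn_scaleAr (l : R[i]) (S T : W) : l *: vn_mulf S T = vn_mulf S (l *: T).
Proof. by apply: vn_inj => x /=; exact/esym/vnZ. Qed.

Let vn_star_eq (S T : W) : adjoint (sval S) (sval T) -> vn_starf S = T.
Proof. by move=> ST; apply: val_inj; exact: adjoint_unique (vn_starfP S) ST. Qed.

Fact vn_starD (S T : W) : vn_starf (S + T) = vn_starf S + vn_starf T.
Proof.
apply: vn_star_eq => x y.
rewrite -[LHS]/(inner (sval S x + sval T x) y).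
rewrite -[RHS]/(inner x (sval (vn_starf S) y + sval (vn_starf T) y)).
by rewrite linearDl linearDr /= !vn_starfP.
Qed.
Fact vn_starZ (l : R[i]) (T : W) :
  vn_starf (l *: T) = Num.conj l *: vn_starf T.
Proof.
apply: vn_star_eq => x y.
rewrite -[LHS]/(inner (l *: sval T x) y).
rewrite -[RHS]/(inner x (Num.conj l *: sval (vn_starf T) y)).
by rewrite linearZl linearZr /= conjCK vn_starfP.
Qed.
Fact vn_starM (S T : W) :
  vn_starf (vn_mulf S T) = vn_mulf (vn_starf T) (vn_starf S).
Proof. by apply: vn_star_eq => x y /=; rewrite !vn_starfP. Qed.
Fact vn_starK : involutive vn_starf.
Proof. by move=> T; apply: vn_star_eq; exact/adjoint_sym/vn_starfP. Qed.

HB.instance Definition _ := Lmodule_isStarAlgebra.Build R W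
  vn_mulA vn_mul1r vn_mulr1 vn_mulDl vn_mulDr vn_scaleAl vn_scaleAr
  vn_starD vn_starZ vn_starM vn_starK.

End VonNeumannStarAlgebra.

(* Main.v *)
Require Import Defs.
From HB Require Import structures.
From mathcomp Require Import all_boot all_order all_algebra.
From mathcomp Require Import sesquilinear complex.
From mathcomp Require Import boolp classical_sets functions reals.
From mathcomp Require Import topology normedtype sequences.
From mathcomp Require Import ring lra.

Set Implicit Arguments.
Unset Strict Implicit.
Unset Printing Implicit Defensive.

Import Order.TTheory GRing.Theory Num.Theory.
Import numFieldNormedType.Exports.

Local Open Scope classical_set_scope.
Local Open Scope ring_scope.
Local Open Scope complex_scope.

(** Why the theorem holds.  Let F denote the map.

    2-positive implies Lieb: the matrix [[a* a, a* b], [b* a, b* b]] is [a b]* [a b],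
    hence positive, and its image is the Cauchy-Schwarz matrix.  If a >= b >= 0, then
    [[a, b], [b, b]] is positive, and compressing its image by the vector (1, -1)
    gives F(a) - F(b) >= 0 ([two_positive_Lieb]).

    Lieb implies 2-positive on a von Neumann algebra: a positive matrix
    [[a, b], [b*, d]] factors as a = s* s, b = s* y with y* y <= d
    ([block_factor]).  Here s = a^(1/2), and y is the strong limit of
    s (a + t)^-1 b as t decreases to 0: the form of the matrix at the vector
    (- (a + t)^-1 b, 1) is nonnegative, which bounds these operators by d
    ([schur_bound]), and their squares increase as t decreases
    ([resolvent_increment]).  The image of the matrix is then the Cauchy-Schwarz
    matrix of (s, y) plus diag (0, F(d) - F(y* y)), and the latter is positive by
    monotonicity.

    Both directions need the order structure of C*-algebras and of their 2 x 2
    matrices, for positivity defined by the spectrum.  The cone of hermitian a such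
    that |t - a| <= t for some t >= 0 is shown to satisfy a list of axioms
    ([spectral_cone]) which force a cone to be the set of positive elements
    ([spectral_coneE]).  The tools are the Neumann series and a square root obtained
    by iteration ([sqrt_near_one]); c* c >= 0 then follows by Kaplansky's argument
    ([norm_positive_starM]).  For 2 x 2 matrices the same axioms hold for the cone
    of those X such that v* X v >= 0 for all columns v, invertibility being read off
    the Schur complement ([form_positive_inv]); this gives the description of
    positive matrices used above ([positive_block2]).  The estimates are made for an
    abstract relation |a| <= c ([cstar_bound]), which both a C*-algebra and a von
    Neumann algebra provide ([cstarAlg_bound], [vn_cstar_bound]). *)

(** * Unital *-algebras *)

Section StarAlgebraTheory.
Variables (R : realType) (A : starAlgType R).
Implicit Types (a b c h : A) (t s : R).

Definition real_scalar t : A := t%:C *: (1 : A).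

Lemma mulZl (l : R[i]) a b : (l *: a) * b = l *: (a * b).
Proof. exact/esym/ascaleAl. Qed.

Lemma mulZr (l : R[i]) a b : a * (l *: b) = l *: (a * b).
Proof. exact/esym/ascaleAr. Qed.

Lemma starMr a b : star (a * b) = star b * star a.
Proof. exact: starM. Qed.

Lemma star0 : star (0 : A) = 0.
Proof. by apply: (addrI (star 0)); rewrite -starD !addr0. Qed.

Lemma starN a : star (- a) = - star a.
Proof. by apply: (addrI (star a)); rewrite -starD !subrr star0. Qed.

Lemma starB a b : star (a - b) = star a - star b.
Proof. by rewrite starD starN. Qed.

Lemma star1 : star (1 : A) = 1.
Proof. by rewrite -[LHS]mul1r -{1}(starK 1) -starMr mul1r starK. Qed.

Lemma scalarM t a : real_scalar t * a = t%:C *: a.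
Proof. by rewrite mulZl mul1r. Qed.

Lemma scalarC t a : real_scalar t * a = a * real_scalar t.
Proof. by rewrite mulZl mulZr mul1r mulr1. Qed.

Lemma star_scalar t : star (real_scalar t) = real_scalar t.
Proof. by rewrite starZ star1 [Num.conj _]conjc_real. Qed.

Lemma scalar0 : real_scalar 0 = 0. Proof. exact: scale0r. Qed.

Lemma scalar1 : real_scalar 1 = 1. Proof. exact: scale1r. Qed.

Lemma scalarD s t : real_scalar (s + t) = real_scalar s + real_scalar t.
Proof. by rewrite /real_scalar rmorphD scalerDl. Qed.

Lemma scalarN t : real_scalar (- t) = - real_scalar t.
Proof. by rewrite /real_scalar rmorphN scaleNr. Qed.

Lemma scalarMs s t : real_scalar (s * t) = real_scalar s * real_scalar t.
Proof. by rewrite scalarM scalerA /real_scalar rmorphM. Qed.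

Lemma scalarK t a : t != 0 -> real_scalar t^-1 * (real_scalar t * a) = a.
Proof. by move=> t0; rewrite mulrA -scalarMs mulVf// scalar1 mul1r. Qed.

Lemma scalarVK t a : t != 0 -> real_scalar t * (real_scalar t^-1 * a) = a.
Proof. by move=> t0; rewrite mulrA -scalarMs mulfV// scalar1 mul1r. Qed.

Lemma addr_self a : a + a = real_scalar 2 * a.
Proof. by rewrite scalarM -mulr2n -scaler_nat rmorph_nat. Qed.

Lemma mulr_subC a b : a * b = b * a -> (a + b) * (a - b) = a * a - b * b.
Proof. by move=> ab; rewrite mulrDl !mulrBr ab addrA subrK. Qed.

Lemma mulr_subCl a b : a * b = b * a -> (a - b) * (a + b) = a * a - b * b.
Proof. by move=> ab; rewrite mulrBl !mulrDr ab opprD addrA addrK. Qed.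

Lemma polarization a b :
  (a + b) * (a + b) - (a - b) * (a - b) = real_scalar 2 * (a * b + b * a).
Proof.
have -> : (a + b) * (a + b) = (a * a + b * b) + (a * b + b * a).
  by rewrite mulrDl !mulrDr [b * a + _]addrC addrACA.
have -> : (a - b) * (a - b) = (a * a + b * b) - (a * b + b * a).
  by rewrite mulrBl !mulrBr opprB addrACA -opprD.
by rewrite opprB addrC addrA subrK addr_self.
Qed.

Lemma star_sqr_self h : star h = h -> star (h * h) = h * h.
Proof. by move=> hh; rewrite starMr hh. Qed.

Lemma invertibleM a b : invertible a -> invertible b -> invertible (a * b).
Proof.
move=> [a' [aa' a'a]] [b' [bb' b'b]]; exists (b' * a'); split.
  by rewrite mulrA -(mulrA a) bb' mulr1.
by rewrite mulrA -(mulrA b') a'a mulr1.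
Qed.

Lemma invertible_scale t a : t != 0 -> invertible a ->
  invertible (real_scalar t * a).
Proof.
move=> t0; apply: invertibleM; exists (real_scalar t^-1).
by rewrite -!scalarMs mulfV// mulVf// scalar1.
Qed.

Lemma inv_comm a b c : a * b = 1 -> b * a = 1 -> a * c = c * a -> b * c = c * b.
Proof.
move=> ab ba ac.
by rewrite -[LHS]mulr1 -ab mulrA -(mulrA b) -ac mulrA ba mul1r.
Qed.

Lemma invertible_comm_factor a b : a * b = b * a -> invertible (a * b) ->
  invertible a.
Proof.
move=> ab [c [abc cab]]; exists (b * c); split; first by rewrite mulrA.
have abb : a * b * b = b * (a * b) by rewrite {1}ab mulrA.
by rewrite -(inv_comm abc cab abb) -mulrA -ab.
Qed.

Lemma inv_herm a b : star a = a -> a * b = 1 -> b * a = 1 -> star b = b.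
Proof.
move=> aa ab ba; have sba : star b * a = 1 by rewrite -aa -starMr ab star1.
by rewrite -[LHS]mulr1 -ab mulrA sba mul1r.
Qed.

(** If c inverts a b - l, then (b c a - 1) / l inverts b a - l, because
    (b a - l) b = b (a b - l). *)
Lemma spectrum_mulC a b (l : R[i]) : l != 0 ->
  spectrum (b * a) l -> spectrum (a * b) l.
Proof.
move=> l0 + [c [ec ce]]; apply.
have shift : (b * a - l *: (1 : A)) * b = b * (a * b - l *: (1 : A)).
  by rewrite mulrBl mulrBr mulZl mulZr mul1r mulr1 mulrA.
have shift' : a * (b * a - l *: (1 : A)) = (a * b - l *: (1 : A)) * a.
  by rewrite mulrBl mulrBr mulZl mulZr mul1r mulr1 mulrA.
exists (l^-1 *: (b * c * a - 1)); split.
  rewrite mulZr mulrBr mulr1 2!mulrA shift -(mulrA b) ec mulr1.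
  by rewrite opprB addrC subrK scalerA mulVf// scale1r.
rewrite mulZl mulrBl mul1r -(mulrA _ a) shift' mulrA -(mulrA b) ce mulr1.
by rewrite opprB addrC subrK scalerA mulVf// scale1r.
Qed.

(** * Cones detecting the spectrum *)

(** Exhibiting one cone with these properties computes [positive_elt].  Unlike the
    axioms of a C*-norm, they pass easily from an algebra to its 2 x 2 matrices. *)
Record spectral_cone (P : A -> Prop) : Prop := SpectralCone {
  cone_herm : forall a, P a -> star a = a;
  cone_add : forall a b, P a -> P b -> P (a + b);
  cone_one : P 1;
  cone_conj : forall a h, P a -> star h = h -> h * a = a * h -> P (h * a * h);
  cone_bounded : forall a, star a = a ->
    exists2 t, 0 < t & P (real_scalar t - a);
  cone_closed : forall a, (forall t, 0 < t -> P (a + real_scalar t)) -> P a;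
  cone_inv : forall a t, 0 < t -> P (a - real_scalar t) -> invertible a
}.

Section SpectralCone.
Variables (P : A -> Prop) (coneP : spectral_cone P).

Lemma cone_scale t a : 0 <= t -> P a -> P (real_scalar t * a).
Proof.
move=> t0 Pa; rewrite -(sqr_sqrtr t0) expr2 scalarMs -mulrA scalarC.
by apply: (cone_conj coneP) => //; [exact: star_scalar | exact: scalarC].
Qed.

Lemma cone_scalar t : 0 <= t -> P (real_scalar t).
Proof. by move=> t0; rewrite -[X in P X]mulr1; exact/cone_scale/(cone_one coneP). Qed.

Lemma cone_sqr h : star h = h -> P (h * h).
Proof.
move=> hh; rewrite -{1}[h]mulr1.
by apply: (cone_conj coneP) => //; [exact: (cone_one coneP)|rewrite mulr1 mul1r].
Qed.

(** If l = x + i y with y <> 0, then a - l is a factor of (a - x) ^ 2 + y ^ 2, which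
    is invertible by [cone_inv]; if l = x < 0, [cone_inv] applies directly. *)
Lemma cone_positive a : P a -> positive_elt a.
Proof.
move=> Pa; split=> [|[x y] sp]; first exact: (cone_herm coneP Pa).
have aa := cone_herm coneP Pa; apply: contrapT => nge0; apply: sp.
have -> : (x +i* y) *: (1 : A) = real_scalar x + (0 +i* y) *: (1 : A).
  by rewrite -scalerDl; congr (_ *: _); simpc.
rewrite opprD addrA; have [y0|y0] := eqVneq y 0.
  rewrite y0 [_ *: (1 : A)]scale0r subr0.
  have x0 : 0 < - x.
    by rewrite oppr_gt0 ltNge; apply/negP => x0; apply: nge0; rewrite y0 lecR.
  by apply: (cone_inv coneP x0); rewrite scalarN opprK subrK.
set h := a - _; set j := (0 +i* y) *: (1 : A).
have hj : h * j = j * h by rewrite mulZl mulZr mul1r mulr1.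
apply: (@invertible_comm_factor _ (h + j)).
  by rewrite mulr_subC// mulr_subCl.
have hP : P (h * h) by apply: cone_sqr; rewrite starB star_scalar aa.
have y2 : 0 < y ^+ 2 by rewrite exprn_even_gt0.
apply: (cone_inv coneP y2); rewrite (_ : _ - _ = h * h)//.
rewrite mulr_subCl//.
have -> : j * j = - real_scalar (y ^+ 2).
  rewrite mulZl mul1r scalerA -scalarN; congr (_ *: _).
  by rewrite expr2; simpc.
by rewrite opprK addrK.
Qed.

(** Let m be the least scalar such that a + m is in P.  If m > 0, then a + m is
    invertible, hence bounded below by a positive scalar, so that m is not least. *)
Lemma positive_cone a : positive_elt a -> P a.
Proof.
move=> [aa spa]; apply: contrapT => nPa.
have [e e0 nPe] : exists2 e, 0 < e & ~ P (a + real_scalar e).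
  apply: contrapT => H; apply: nPa; apply: (cone_closed coneP) => t t0.
  by apply: contrapT => nP; apply: H; exists t.
pose E : set R := [set t | P (a + real_scalar t)].
have upE s t : E s -> s <= t -> E t.
  move=> Es st; have -> : t = s + (t - s) by rewrite addrC subrK.
  rewrite /E/= scalarD addrA; apply: (cone_add coneP) => //.
  by apply: cone_scalar; rewrite subr_ge0.
have [K K0] : exists2 K, 0 < K & P (real_scalar K - - a).
  by apply: (cone_bounded coneP); rewrite starN aa.
rewrite opprK addrC => EK.
have lbE : lbound E e.
  move=> t Et; rewrite leNgt; apply/negP => te; apply: nPe.
  by apply: (upE t) => //; exact: ltW.
have infE : has_inf E by split; [exists K | exists e].
have [m Em] : exists m, m = inf E by exists (inf E).
have m0 : 0 < m.
  by rewrite Em; apply: (lt_le_trans e0); apply: lb_le_inf => //; exists K.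
pose S := a + real_scalar m; have PS : P S.
  apply: (cone_closed coneP) => t t0; have [u Eu um] := inf_adherent t0 infE.
  rewrite -Em in um.
  by rewrite -addrA -scalarD; exact: (upE u) (ltW um).
have SS := cone_herm coneP PS.
have [T [ST TS]] : invertible S.
  apply: contrapT => nS; have /= := spa (- m%:C).
  rewrite oppr_ge0 lecR leNgt m0 /=; suff: spectrum a (- m%:C) by move=> h /(_ h).
  by rewrite /spectrum/= scaleNr opprK.
have TT : star T = T := inv_herm SS ST TS.
(* S is bounded below: S ^ 2 >= 1 / K1 because its inverse is bounded, and
   S >= S ^ 2 / K2 because K2 S (K2 - S) = S (K2 - S) S + (K2 - S) S (K2 - S). *)
have [K1 K10 PK1] := cone_bounded coneP (star_sqr_self TT).
have [K2 K20 PK2] := cone_bounded coneP SS.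
have P1 : P (real_scalar K1 * (S * S) - 1).
  have -> : real_scalar K1 * (S * S) - 1 = S * (real_scalar K1 - T * T) * S.
    by rewrite mulrBr mulrBl -scalarC -mulrA (mulrA S T) ST mul1r TS.
  apply: (cone_conj coneP) => //; rewrite mulrBr mulrBl scalarC.
  by rewrite mulrA ST mul1r -mulrA TS mulr1.
have P2 : P (real_scalar K2 * S - S * S).
  set D := real_scalar K2 - S in PK2; have DS : D * S = S * D.
    by rewrite mulrBl mulrBr scalarC.
  have DD : star D = D := cone_herm coneP PK2.
  rewrite -[X in P X](@scalarK K2) ?gt_eqF//.
  apply: cone_scale; first by rewrite invr_ge0 ltW.
  have -> : real_scalar K2 * (real_scalar K2 * S - S * S) = S * D * S + D * S * D.
    have K2D : real_scalar K2 = S + D by rewrite addrC subrK.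
    by rewrite -mulrBl -/D {1}K2D mulrDl -!mulrA DS !mulrA.
  by apply: (cone_add coneP); apply: (cone_conj coneP).
have K12 : 0 < K1 * K2 by rewrite mulr_gt0.
have PSK : P (S - real_scalar (K1 * K2)^-1).
  rewrite -[X in P X](@scalarK (K1 * K2)) ?gt_eqF//.
  apply: cone_scale; first by rewrite invr_ge0 ltW.
  rewrite mulrBr -scalarMs mulfV ?gt_eqF// scalar1.
  have -> : real_scalar (K1 * K2) * S - 1 =
      (real_scalar K1 * (S * S) - 1) + real_scalar K1 * (real_scalar K2 * S - S * S).
    by rewrite mulrBr (mulrA _ (real_scalar K2)) -scalarMs [RHS]addrC addrA subrK.
  by apply: (cone_add coneP) => //; apply: cone_scale; first exact: ltW.
have Em' : P (a + real_scalar (m - (K1 * K2)^-1)).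
  by rewrite scalarD scalarN addrA.
have := ge_inf (proj2 infE) (Em' : E _).
by rewrite -Em lerBrDr gerDl leNgt invr_gt0 K12.
Qed.

Lemma spectral_coneE a : P a <-> positive_elt a.
Proof. by split; [exact: cone_positive | exact: positive_cone]. Qed.

End SpectralCone.
End StarAlgebraTheory.
Arguments real_scalar {R A} t.

Section CstarBoundTheory.
Variables (R : realType) (A : starAlgType R).
Implicit Types (a b : A).

(** * Norm bounds, inverses and square roots *)

(** [bnd a c] stands for [|a| <= c].  Bounds rather than norms are axiomatised
    because for operators on a Hilbert space the bound is directly
    [|T x| <= c |x|], without a supremum.  Completeness is stated for sequences
    whose increments are majorised by those of a bounded real sequence. *)
Record cstar_bound (bnd : A -> R -> Prop) : Prop := CstarBound {
  bnd_ge0 : forall a c, bnd a c -> 0 <= c;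
  bnd_le : forall a c d, bnd a c -> c <= d -> bnd a d;
  bnd_ex : forall a, exists c, bnd a c;
  bnd_one : bnd 1 1;
  bnd_add : forall a b c d, bnd a c -> bnd b d -> bnd (a + b) (c + d);
  bnd_mul : forall a b c d, bnd a c -> bnd b d -> bnd (a * b) (c * d);
  bnd_scale : forall (l : R[i]) s a c, `|l| = s%:C -> bnd a c ->
    bnd (l *: a) (s * c);
  bnd_star : forall a c, bnd a c -> bnd (star a) c;
  bnd_cstar : forall a c, 0 <= c -> bnd (star a * a) (c ^+ 2) -> bnd a c;
  bnd_closed : forall a c, (forall e, 0 < e -> bnd a (c + e)) -> bnd a c;
  bnd_eq0 : forall a, bnd a 0 -> a = 0;
  bnd_complete : forall (u : nat -> A) (r : nat -> R) M,
    (forall n, bnd (u n.+1 - u n) (r n.+1 - r n)) -> (forall n, r n <= M) ->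
    exists l, forall e, 0 < e -> exists N, forall n, (N <= n)%N ->
      bnd (u n - l) e
}.

Section CstarBound.
Variables (bnd : A -> R -> Prop) (bndP : cstar_bound bnd).

Lemma bnd_scalar s t a c : `|t| <= s -> bnd a c -> bnd (real_scalar t * a) (s * c).
Proof.
move=> ts ac; rewrite scalarM; apply: (bnd_le bndP (c := `|t| * c)).
  by apply: (bnd_scale bndP) => //; rewrite normc_def /= expr0n addr0 sqrtr_sqr.
by rewrite ler_wpM2r ?(bnd_ge0 bndP ac).
Qed.

Lemma bnd_opp a c : bnd a c -> bnd (- a) c.
Proof.
move=> ac; rewrite -scaleN1r -[c]mul1r; apply: (bnd_scale bndP) => //.
by rewrite normrN1.
Qed.

Lemma bnd_oppE a c : bnd (- a) c -> bnd a c.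
Proof. by move=> /bnd_opp; rewrite opprK. Qed.

Lemma bnd_sub a b c d : bnd a c -> bnd b d -> bnd (a - b) (c + d).
Proof. by move=> ac bd; apply: (bnd_add bndP) => //; exact: bnd_opp. Qed.

Lemma bnd_real t : 0 <= t -> bnd (real_scalar t) t.
Proof.
move=> t0; rewrite -[real_scalar t]mulr1 -[X in bnd _ X]mulr1.
by apply: bnd_scalar; [rewrite ger0_norm | exact: (bnd_one bndP)].
Qed.

Lemma bnd_zero c : 0 <= c -> bnd 0 c.
Proof.
move=> c0; apply: (bnd_le bndP (c := 0)) => //.
by rewrite -scalar0; exact: bnd_real.
Qed.

Lemma bnd_ex_gt0 a : exists2 c, 0 < c & bnd a c.
Proof.
have [c ac] := bnd_ex bndP a; have c0 := bnd_ge0 bndP ac.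
by exists (c + 1); [rewrite ltr_wpDl | apply: (bnd_le bndP ac); rewrite lerDl].
Qed.

Lemma bnd_small_eq0 a : (forall e, 0 < e -> bnd a e) -> a = 0.
Proof.
move=> ae; apply: (bnd_eq0 bndP); apply: (bnd_closed bndP) => e e0.
by rewrite add0r; exact: ae.
Qed.

Definition tends (u : nat -> A) l :=
  forall e, 0 < e -> exists N, forall n, (N <= n)%N -> bnd (u n - l) e.

Lemma tends_cst l : tends (fun=> l) l.
Proof. by move=> e e0; exists 0%N => n _; rewrite subrr; apply/bnd_zero/ltW. Qed.

Lemma tends_shift u l : tends u l -> tends (fun n => u n.+1) l.
Proof. by move=> ul e /ul [N Nu]; exists N => n Nn; exact/Nu/leqW. Qed.

Lemma tends_unique u k l : tends u k -> tends u l -> k = l.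
Proof.
move=> uk ul; apply/eqP; rewrite -subr_eq0; apply/eqP/bnd_small_eq0 => e e0.
have e2 : 0 < e / 2 by rewrite divr_gt0.
have [[M Mu] [N Nu]] := (uk _ e2, ul _ e2); pose n := maxn M N.
rewrite -[k](subrK (u n)) -addrA [e]splitr; apply: (bnd_add bndP).
  by apply: bnd_oppE; rewrite opprB; apply/Mu/leq_maxl.
by apply/Nu/leq_maxr.
Qed.

Lemma tends_add u v k l : tends u k -> tends v l ->
  tends (fun n => u n + v n) (k + l).
Proof.
move=> uk vl e e0; have e2 : 0 < e / 2 by rewrite divr_gt0.
have [[M Mu] [N Nu]] := (uk _ e2, vl _ e2); exists (maxn M N) => n.
rewrite geq_max => /andP[Mn Nn]; rewrite opprD addrACA [e]splitr.
by apply: (bnd_add bndP); [exact: Mu | exact: Nu].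
Qed.

Lemma tends_mul u v k l : tends u k -> tends v l ->
  tends (fun n => u n * v n) (k * l).
Proof.
move=> uk vl e e0; have [[c c0 kc] [d d0 ld]] := (bnd_ex_gt0 k, bnd_ex_gt0 l).
pose f := Num.min 1 (e / (1 + c + d)).
have f0 : 0 < f by rewrite lt_min ltr01 divr_gt0// !addr_gt0.
have [[M Mu] [N Nu]] := (uk _ f0, vl _ f0); exists (maxn M N) => n.
rewrite geq_max => /andP[/Mu un /Nu vn].
have -> : u n * v n - k * l =
    (u n - k) * (v n - l) + k * (v n - l) + (u n - k) * l.
  by rewrite -mulrDl subrK mulrBr mulrBl addrA subrK.
apply: (bnd_le bndP (c := f * f + c * f + f * d)).
  by do ![apply: (bnd_add bndP) | apply: (bnd_mul bndP)].
have f1 : f <= 1 by rewrite ge_min lexx.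
have fe : f * (1 + c + d) <= e.
  by rewrite -ler_pdivlMr ?addr_gt0// ge_min lexx orbT.
by apply: le_trans fe; nra.
Qed.

Lemma tends_star u l : tends u l -> tends (fun n => star (u n)) (star l).
Proof.
move=> ul e e0; have [N Nu] := ul _ e0; exists N => n Nn.
by rewrite -starB; apply: (bnd_star bndP); exact: Nu.
Qed.

Lemma tends_bnd u l c : tends u l -> (forall n, bnd (u n) c) -> bnd l c.
Proof.
move=> ul uc; apply: (bnd_closed bndP) => e e0; have [N Nu] := ul _ e0.
rewrite -[l](subrK (u N)) addrC -[l - _]opprB; apply: (bnd_add bndP) => //.
by apply: bnd_opp; exact: Nu.
Qed.

Lemma tends_ext u v l : u =1 v -> tends u l -> tends v l.
Proof. by move=> uv ul e /ul [N Nu]; exists N => n Nn; rewrite -uv; exact: Nu. Qed.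

Lemma tends_comm u l b : tends u l -> (forall n, u n * b = b * u n) ->
  l * b = b * l.
Proof.
move=> ul ub; apply: (@tends_unique (fun n => u n * b)).
  exact: tends_mul (tends_cst b).
by apply: (tends_ext (fun n => esym (ub n))); exact: tends_mul (tends_cst b) ul.
Qed.

(** The inverse of 1 - x is the fixed point of l |-> 1 + x l, approached by
    iteration from 0. *)
Lemma neumann x c : c < 1 -> bnd x c -> invertible (1 - x).
Proof.
move=> c1 xc; have c0 := bnd_ge0 bndP xc.
pose u n := iter n (fun l => 1 + x * l) 0; pose r n := iter n (fun s => 1 + c * s) 0.
have uS n : u n.+1 = 1 + x * u n by [].
have rS n : r n.+1 = 1 + c * r n by [].
have ur n : bnd (u n.+1 - u n) (r n.+1 - r n).
  elim: n => [|n IH]; first by rewrite /= !mulr0 !addr0 !subr0; exact: (bnd_one bndP).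
  have -> : u n.+2 - u n.+1 = x * (u n.+1 - u n).
    by rewrite (uS n.+1) [in X in _ - X]uS mulrBr [1 + _]addrC addrKA.
  have -> : r n.+2 - r n.+1 = c * (r n.+1 - r n).
    by rewrite (rS n.+1) [in X in _ - X]rS mulrBr [1 + _]addrC addrKA.
  exact: (bnd_mul bndP).
have rM n : r n <= (1 - c)^-1.
  elim: n => [|n IH]; first by rewrite invr_ge0 subr_ge0 ltW.
  have : 1 + c * r n <= 1 + c * (1 - c)^-1 by rewrite lerD2l ler_wpM2l.
  by congr (_ <= _); field; rewrite subr_eq0 gt_eqF.
have [l ul] : exists l, tends u l := bnd_complete bndP ur rM.
have lE : l = 1 + x * l.
  apply: (tends_unique (tends_shift ul)); apply: (tends_add (tends_cst 1)).
  exact: tends_mul (tends_cst x) ul.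
have lx : l * x = x * l.
  apply: (tends_comm ul) => n; elim: n => [|n IH]; first by rewrite mul0r mulr0.
  by rewrite uS mulrDl mulrDr mul1r mulr1 -mulrA IH.
by exists l; rewrite mulrBl mulrBr mulr1 mul1r lx {1 3}lE addrK.
Qed.

(** The square root of 1 - x for [|x| <= 1] is 1 - q with q = (x + q ^ 2) / 2.
    Iterating from 0, the increments are dominated by those of the same iteration
    in the reals at x = 1, which increases to 1; hence the boundary case is
    covered. *)
Lemma sqrt_near_one x : star x = x -> bnd x 1 ->
  exists q, [/\ star q = q, bnd q 1, (1 - q) * (1 - q) = 1 - x &
    forall b, x * b = b * x -> q * b = b * q].
Proof.
move=> xx x1; pose h : A := real_scalar 2^-1.
pose u n := iter n (fun q => h * (x + q * q)) 0.
pose r n : R := iter n (fun s => 2^-1 * (1 + s * s)) 0.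
have uS n : u n.+1 = h * (x + u n * u n) by [].
have rS n : r n.+1 = 2^-1 * (1 + r n * r n) by [].
have h0 : `|2^-1 : R| <= 2^-1 by rewrite ger0_norm ?invr_ge0 ?ler0n.
have r01 n : 0 <= r n <= 1.
  by elim: n => [|n /andP[]]; rewrite ?lexx ?ler01// rS; nra.
have uC b n : x * b = b * x -> u n * b = b * u n.
  move=> xb; elim: n => [|n IH]; first by rewrite mul0r mulr0.
  rewrite uS mulrA -scalarC -!mulrA; congr (_ * _).
  by rewrite mulrDl mulrDr xb -mulrA IH mulrA IH mulrA.
have uu n : star (u n) = u n.
  elim: n => [|n IH]; first exact: star0.
  by rewrite uS starMr star_scalar -scalarC starD starMr IH xx.
have ub n : bnd (u n) (r n).
  elim: n => [|n IH]; first exact: bnd_zero.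
  rewrite uS rS; apply: bnd_scalar => //.
  by apply: (bnd_add bndP) => //; exact: (bnd_mul bndP).
have ur n : bnd (u n.+1 - u n) (r n.+1 - r n).
  elim: n => [|n IH]; first by rewrite /u /r [iter 0 _ _]/= !subr0; exact: ub 1%N.
  have un : u n.+1 * u n = u n * u n.+1.
    exact: (uC _ n.+1 (esym (uC x n erefl))).
  have -> : u n.+2 - u n.+1 = h * ((u n.+1 + u n) * (u n.+1 - u n)).
    rewrite mulr_subC// (uS n.+1) [in X in _ - X]uS -mulrBr; congr (_ * _).
    by rewrite [x + _]addrC addrKA.
  have -> : r n.+2 - r n.+1 = 2^-1 * ((r n.+1 + r n) * (r n.+1 - r n)).
    by rewrite (rS n.+1) [in X in _ - X]rS; ring.
  apply: bnd_scalar => //; apply: (bnd_mul bndP) => //.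
  by apply: (bnd_add bndP).
have rM n : r n <= 1 by have /andP[] := r01 n.
have [q uq] : exists q, tends u q := bnd_complete bndP ur rM.
exists q; split.
- by apply: (tends_unique (tends_star uq)); apply: (tends_ext _ uq) => n.
- by apply: (tends_bnd uq) => n; exact: (bnd_le bndP (ub n)).
- have qE : q = h * (x + q * q).
    apply: (tends_unique (tends_shift uq)); apply: (tends_mul (tends_cst h)).
    by apply: (tends_add (tends_cst x)); exact: tends_mul.
  have q2 : q + q = x + q * q.
    by rewrite addr_self {1}qE /h scalarVK// pnatr_eq0.
  rewrite mulrBl mul1r mulrBr mulr1 opprB [q * q - q]addrC addrA -addrA.
  by rewrite -addrA [- q + _]addrA -opprD q2 opprD subrK.
- by move=> b xb; apply: (tends_comm uq) => n; exact: uC.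
Qed.

(** * Positive elements of a C*-algebra *)

(** The spectrum of such an element lies in [0, 2 t].  Defining positivity by the
    norm makes stability under sums immediate, and dispenses with the spectral radius
    formula. *)
Definition norm_positive a :=
  star a = a /\ exists2 t, 0 <= t & bnd (real_scalar t - a) t.

(** Rescaling to t = 1 reduces to [sqrt_near_one]; the root 1 - q is itself positive
    because |q| <= 1. *)
Lemma norm_positive_sqrt a : norm_positive a ->
  exists s, [/\ norm_positive s, s * s = a & forall b, a * b = b * a -> s * b = b * s].
Proof.
move=> [aa [t t0 at_]]; pose T := t + 1; have T0 : 0 < T by rewrite ltr_wpDl.
have aT : bnd (real_scalar T - a) T.
  rewrite /T scalarD addrAC; apply: (bnd_add bndP) => //; exact: bnd_real.
pose x : A := 1 - real_scalar T^-1 * a.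
have xE : x = real_scalar T^-1 * (real_scalar T - a).
  by rewrite mulrBr -scalarMs mulVf ?gt_eqF// scalar1.
have x1 : bnd x 1.
  rewrite xE -(mulVf (lt0r_neq0 T0)); apply: bnd_scalar => //.
  by rewrite ger0_norm// invr_ge0 ltW.
have xx : star x = x by rewrite starB star1 starMr star_scalar aa -scalarC.
have [q [qq q1 q2 qC]] := sqrt_near_one xx x1.
have sq0 := sqrtr_ge0 T; exists (real_scalar (Num.sqrt T) * (1 - q)); split.
- split; first by rewrite starMr star_scalar starB star1 qq scalarC.
  exists (Num.sqrt T) => //.
  rewrite mulrBr mulr1 opprB addrC subrK -[X in bnd _ X]mulr1.
  by apply: bnd_scalar => //; rewrite ger0_norm.
- rewrite mulrA -(mulrA _ (1 - q)) -scalarC mulrA -scalarMs -mulrA q2.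
  rewrite -expr2 sqr_sqrtr ?ltW// /x opprB addrC subrK.
  exact/scalarVK/lt0r_neq0.
- move=> b ab; rewrite mulrA -scalarC -!mulrA; congr (_ * _).
  rewrite mulrBl mulrBr mul1r mulr1 qC// /x mulrBl mulrBr mul1r mulr1.
  by rewrite mulrA -scalarC -!mulrA ab.
Qed.

(** For commuting hermitian h and k, u = h + i k satisfies u* u = h ^ 2 + k ^ 2,
    and k is the imaginary part of u. *)
Lemma bnd_imaginary_part h k c : star h = h -> star k = k -> h * k = k * h ->
  0 <= c -> bnd (h * h + k * k) (c ^+ 2) -> bnd k c.
Proof.
move=> hh kk hk c0 hkc; pose i : R[i] := 0 +i* 1; pose u : A := h + i *: k.
have ii : i * i = -1 by rewrite /i; simpc.
have su : star u = h - i *: k.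
  rewrite starD hh starZ kk -scaleNr; congr (_ + _ *: _).
  by rewrite -[LHS]/(conjc i) /i; simpc.
have uc : bnd u c.
  apply: (bnd_cstar bndP) => //; rewrite su mulr_subCl; last first.
    by rewrite mulZl mulZr hk.
  by rewrite mulZl mulZr scalerA ii scaleN1r opprK.
have -> : k = (0 +i* - 2^-1 : R[i]) *: (u - star u).
  rewrite su /u opprB addrC addrA subrK -scalerDl scalerA -[LHS]scale1r.
  by congr (_ *: _); rewrite /i; simpc; congr (_ +i* _); field.
rewrite -[c]mul1r -[X in X * c](mulVf (_ : 2 != 0)) ?pnatr_eq0// -mulrA.
apply: (bnd_scale bndP).
  by rewrite normc_def /= expr0n add0r sqrrN sqrtr_sqr ger0_norm// invr_ge0.
by rewrite mulr_natl mulr2n; apply: bnd_sub => //; exact: (bnd_star bndP).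
Qed.

(** For c = 1, let k be the square root of 1 - h ^ 2: then h ^ 2 + k ^ 2 = 1, so
    that |k| <= 1 by [bnd_imaginary_part].  The point is that c is any bound of h,
    which is what makes the cone closed. *)
Lemma bnd_sqr_defect h c : star h = h -> bnd h c ->
  bnd (real_scalar (c ^+ 2) - h * h) (c ^+ 2).
Proof.
move=> hh hc; have c0 := bnd_ge0 bndP hc.
have [cE|cn0] := eqVneq c 0.
  rewrite cE in hc *; rewrite expr0n/= scalar0 (bnd_eq0 bndP hc) mulr0 subr0.
  exact: bnd_zero.
have cV : `|c^-1| <= c^-1 by rewrite ger0_norm// invr_ge0.
pose g := real_scalar c^-1 * h.
have gg : star g = g by rewrite starMr star_scalar hh -scalarC.
have g1 : bnd g 1 by rewrite -(mulVf cn0); exact: bnd_scalar.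
have g21 : bnd (g * g) 1 by rewrite -[1]mulr1; exact: (bnd_mul bndP).
have [q [qq _ q2 qC]] := sqrt_near_one (star_sqr_self gg) g21.
have k1 : bnd (1 - q) 1.
  apply: (@bnd_imaginary_part g) => //.
  - by rewrite starB star1 qq.
  - by rewrite mulrBr mulrBl mulr1 mul1r qC// mulrA.
  - by rewrite q2 addrC subrK expr1n; exact: (bnd_one bndP).
have -> : real_scalar (c ^+ 2) - h * h = real_scalar (c ^+ 2) * ((1 - q) * (1 - q)).
  rewrite q2 mulrBr mulr1; congr (_ - _).
  have cg : real_scalar c * g = h by exact: scalarVK.
  rewrite expr2 scalarMs -mulrA (mulrA _ g g) cg.
  by rewrite mulrA scalarC -mulrA cg.
rewrite -[X in bnd _ X]mulr1; apply: bnd_scalar; first by rewrite ger0_norm ?sqr_ge0.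
by rewrite -[X in bnd _ X]mulr1; exact: (bnd_mul bndP).
Qed.

Lemma norm_positive_sqr h : star h = h -> norm_positive (h * h).
Proof.
move=> hh; split; first exact: star_sqr_self.
have [c hc] := bnd_ex bndP h; exists (c ^+ 2); first exact: sqr_ge0.
exact: bnd_sqr_defect.
Qed.

Lemma norm_positive_cone : spectral_cone norm_positive.
Proof.
split.
- by move=> a [].
- move=> a b [aa [s s0 as_]] [bb [t t0 bt]]; split; first by rewrite starD aa bb.
  exists (s + t); first exact: addr_ge0.
  by rewrite scalarD opprD addrACA; exact: (bnd_add bndP).
- by rewrite -[1]mulr1; apply: norm_positive_sqr; rewrite star1.
- move=> a h /norm_positive_sqrt [s [[ss _] sa sC]] hh ha.
  have sh : s * h = h * s by exact: sC.
  have -> : h * a * h = (s * h) * (s * h) by rewrite {1}sh -sa !mulrA.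
  by apply: norm_positive_sqr; rewrite starMr hh ss.
- move=> a aa; have [t t0 ta] := bnd_ex_gt0 a; exists t => //.
  split; first by rewrite starB star_scalar aa.
  by exists t; [exact: ltW | rewrite opprB addrC subrK].
- move=> a Pa; have aa : star a = a.
    by have [] := Pa 1 ltr01; rewrite starD star_scalar => /addIr.
  split=> //; have [c c0 ac] := bnd_ex_gt0 a; exists c; first exact: ltW.
  (* the same c works for every a + t = s ^ 2, up to t *)
  apply: (bnd_closed bndP) => t t0.
  have [s [[ss _] sa _]] := norm_positive_sqrt (Pa t t0).
  have ct0 : 0 <= c + t by rewrite addr_ge0 ?ltW.
  have sc : bnd s (Num.sqrt (c + t)).
    apply: (bnd_cstar bndP); rewrite ?sqrtr_ge0// ss sa sqr_sqrtr//.
    by apply: (bnd_add bndP) => //; exact/bnd_real/ltW.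
  have := bnd_sqr_defect ss sc.
  by rewrite sqr_sqrtr// sa scalarD [a + _]addrC addrKA.
- move=> a t t0 [_ [s s0 sa]]; have st0 : 0 < s + t by rewrite ltr_wpDl.
  have -> : a = real_scalar (s + t) * (1 - real_scalar (s + t)^-1 * (real_scalar s - (a - real_scalar t))).
    rewrite mulrBr mulr1 scalarVK ?gt_eqF// scalarD.
    by rewrite opprB addrC addrA !subrK.
  apply: invertible_scale; first by rewrite gt_eqF.
  apply: (@neumann _ ((s + t)^-1 * s)).
    by rewrite mulrC ltr_pdivrMr// mul1r ltrDl.
  by apply: bnd_scalar => //; rewrite ger0_norm// invr_ge0 ltW.
Qed.

Lemma norm_positiveE : norm_positive = @positive_elt R A.
Proof. by apply/funext => a; apply/propext/(spectral_coneE norm_positive_cone). Qed.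

(** If a = s ^ 2 and - a = k ^ 2, then s ^ 2 + k ^ 2 = 0 bounds k by 0. *)
Lemma norm_positive_cap a : norm_positive a -> norm_positive (- a) -> a = 0.
Proof.
move=> /norm_positive_sqrt [s [[ss _] sa sC]] /norm_positive_sqrt [k [[kk _] ka kC]].
have sk : s * k = k * s by apply/sC/esym/kC; rewrite mulNr mulrN.
rewrite -[a]opprK -ka [k](bnd_eq0 bndP) ?mulr0 ?oppr0//.
apply: (@bnd_imaginary_part s) => //.
by rewrite sa ka subrr; apply: bnd_zero; rewrite expr0n.
Qed.

(** With u = |x|, the element w = u - x is twice the negative part of x: it is
    orthogonal to u + x, and vanishes as soon as w u w does. *)
Lemma negative_part x : star x = x -> exists u w,
  [/\ norm_positive u, star w = w, norm_positive (w * u * w),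
      w * x * w = - (w * u * w) & w * u * w = 0 -> x = u].
Proof.
move=> xx; have [u [up ux uC]] := norm_positive_sqrt (norm_positive_sqr xx).
have uu : star u = u by have [] := up.
have xu : u * x = x * u by apply: uC; rewrite mulrA.
exists u, (u - x); set w := u - x.
have ww : star w = w by rewrite starB uu xx.
have wu : w * u = u * w by rewrite mulrBl mulrBr xu.
have w0 : w * (u + x) = 0 by rewrite mulr_subCl// ux subrr.
split=> //.
- exact: (cone_conj norm_positive_cone).
- by apply/eqP; rewrite -addr_eq0 -mulrDl -mulrDr [x + u]addrC w0 mul0r.
- move=> wuw; have wxw : w * x * w = 0.
    by rewrite -[LHS]add0r -{1}wuw -mulrDl -mulrDr w0 mul0r.
  have www : w * w * w = 0.
    have -> : w * w = w * u - w * x by rewrite -mulrBr.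
    by rewrite mulrBl wuw wxw subrr.
  have w2 : w * w = 0.
    apply: (bnd_eq0 bndP); apply: (bnd_cstar bndP) => //.
    by rewrite star_sqr_self// mulrA www mul0r expr0n; exact: bnd_zero.
  have : w = 0.
    apply: (bnd_eq0 bndP); apply: (bnd_cstar bndP) => //.
    by rewrite ww w2 expr0n; exact: bnd_zero.
  by move=> /eqP; rewrite subr_eq0 => /eqP.
Qed.

(** With w twice the negative part of c* c and d = c w, the element d* d is
    negative; as d* d + d d* is a sum of squares, d d* is positive, hence so is
    d* d, which has the same nonzero spectrum.  So d* d = 0, and w = 0. *)
Lemma norm_positive_starM c : norm_positive (star c * c).
Proof.
have xx : star (star c * c) = star c * c by rewrite starMr starK.
have [u [w [up ww wuw wxw wE]]] := negative_part xx.
pose d := c * w.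
have dd : star d * d = - (w * u * w) by rewrite -wxw starMr ww !mulrA.
have ddp : norm_positive (d * star d).
  pose i : R[i] := 0 +i* 1; have ii : i * i = -1 by rewrite /i; simpc.
  have h1 : star (d + star d) = d + star d by rewrite starD starK addrC.
  have h2 : star (i *: (d - star d)) = i *: (d - star d).
    rewrite starZ starB starK -[d - _]opprB scalerN -scaleNr; congr (_ *: _).
    by rewrite -[LHS]/(conjc i) /i; simpc.
  have e : d * star d = real_scalar 2^-1 * ((d + star d) * (d + star d) +
      (i *: (d - star d)) * (i *: (d - star d))) + w * u * w.
    rewrite mulZl mulZr scalerA ii scaleN1r polarization scalarK ?pnatr_eq0//.
    by rewrite dd subrK.
  rewrite e; apply: (cone_add norm_positive_cone) => //.
  apply: (cone_scale norm_positive_cone); first by rewrite invr_ge0.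
  by apply: (cone_add norm_positive_cone); exact: norm_positive_sqr.
have : norm_positive (star d * d).
  rewrite norm_positiveE in ddp *; split; first by rewrite starMr starK.
  move=> l; have [->//|l0] := eqVneq l 0.
  by move=> /(spectrum_mulC l0); exact: (proj2 ddp).
rewrite dd => ddn; rewrite wE//.
by apply: norm_positive_cap.
Qed.

Lemma norm_positive_conj a v : norm_positive a -> norm_positive (star v * a * v).
Proof.
move=> /norm_positive_sqrt [s [[ss _] <- _]].
have -> : star v * (s * s) * v = star (s * v) * (s * v).
  by rewrite starMr ss !mulrA.
exact: norm_positive_starM.
Qed.

Lemma positive_elt_cone : spectral_cone (@positive_elt R A).
Proof. by rewrite -norm_positiveE; exact: norm_positive_cone. Qed.

Lemma positive_elt_conj a v : positive_elt a -> positive_elt (star v * a * v).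
Proof. by rewrite -norm_positiveE; exact: norm_positive_conj. Qed.

Lemma positive_elt_sqrt a : positive_elt a ->
  exists s, [/\ positive_elt s, s * s = a & forall b, a * b = b * a -> s * b = b * s].
Proof. by rewrite -norm_positiveE; exact: norm_positive_sqrt. Qed.

End CstarBound.

End CstarBoundTheory.

(** * Positivity of 2 x 2 matrices *)

Section MatrixPositivity.
Variables (R : realType) (A : starAlgType R).
(* Sums and products are those of the *-algebra M_2(A), not of the matrix ring. *)
Local Notation M2 := (StarAlgebra.sort (matalg A 2 : starAlgType R)).
Implicit Types (a b c d p q r v w : A) (X Y V : M2).

Lemma block2P X Y : (X : 'M[A]_2) 0 0 = (Y : 'M[A]_2) 0 0 ->
  (X : 'M[A]_2) 0 1 = (Y : 'M[A]_2) 0 1 -> (X : 'M[A]_2) 1 0 = (Y : 'M[A]_2) 1 0 ->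
  (X : 'M[A]_2) 1 1 = (Y : 'M[A]_2) 1 1 -> X = Y.
Proof.
move=> e00 e01 e10 e11; apply/matrixP => i j.
have I2 (k : 'I_2) : (k = 0) \/ (k = 1).
  by case: k => [[|[|//]] ?]; [left|right]; exact/val_inj.
by case: (I2 i) => ->; case: (I2 j) => ->.
Qed.

Lemma block2_surj X : exists a b c d, X = block2 a b c d.
Proof.
exists ((X : 'M[A]_2) 0 0), ((X : 'M[A]_2) 0 1), ((X : 'M[A]_2) 1 0), ((X : 'M[A]_2) 1 1).
by apply: block2P; rewrite mxE.
Qed.

Lemma block2_inj a b c d a' b' c' d' :
  block2 a b c d = block2 a' b' c' d' -> [/\ a = a', b = b', c = c' & d = d'].
Proof.
move=> /matrixP e; have := (e 0 0, e 0 1, e 1 0, e 1 1).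
by rewrite !mxE /= => -[[[-> ->] ->] ->].
Qed.

Lemma mul_block2 a b c d a' b' c' d' :
  (block2 a b c d : M2) * block2 a' b' c' d' =
  block2 (a * a' + b * c') (a * b' + b * d') (c * a' + d * c') (c * b' + d * d').
Proof.
by apply: block2P; rewrite [LHS]mxE !big_ord_recl big_ord0 !mxE /= addr0.
Qed.

Lemma add_block2 a b c d a' b' c' d' :
  (block2 a b c d : M2) + block2 a' b' c' d' =
  block2 (a + a') (b + b') (c + c') (d + d').
Proof. by apply: block2P; rewrite !mxE. Qed.

Lemma opp_block2 a b c d :
  - (block2 a b c d : M2) = block2 (- a) (- b) (- c) (- d).
Proof. by apply: block2P; rewrite !mxE. Qed.

Lemma star_block2 a b c d :
  star (block2 a b c d : M2) = block2 (star a) (star c) (star b) (star d).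
Proof. by apply: block2P; rewrite !mxE. Qed.

Lemma scalar_block2 t :
  real_scalar t = block2 (real_scalar t) 0 0 (real_scalar t) :> M2.
Proof. by apply: block2P; rewrite !mxE/= ?scaler0. Qed.

Lemma one_block2 : 1 = block2 1 0 0 1 :> M2.
Proof. by apply: block2P; rewrite !mxE. Qed.

Definition corner (X : M2) : A := (X : 'M[A]_2) 0 0.

Lemma cornerE a b c d : corner (block2 a b c d) = a.
Proof. by rewrite /corner mxE. Qed.

Lemma corner_form a b c d v w x y :
  corner (star (block2 v x w y : M2) * block2 a b c d * block2 v x w y) =
  star v * (a * v + b * w) + star w * (c * v + d * w).
Proof.
rewrite star_block2 !mul_block2 cornerE !mulrDl !mulrDr !mulrA.
by rewrite addrACA.
Qed.

Lemma cornerD X Y : corner (X + Y) = corner X + corner Y.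
Proof. by rewrite /corner mxE. Qed.

Lemma corner_scalar t X : corner (real_scalar t * X) = real_scalar t * corner X.
Proof. by rewrite !scalarM /corner mxE. Qed.

Hypothesis posA : spectral_cone (@positive_elt R A).
Hypothesis conjA : forall a v, positive_elt a -> positive_elt (star v * a * v).

Lemma positive_starM v : positive_elt (star v * v).
Proof. by have := conjA v (cone_one posA); rewrite mulr1. Qed.

(** The corner of V* X V is v* X v for v the first column of V; square matrices V
    make conjugations compose by associativity. *)
Definition form_positive X :=
  star X = X /\ forall V, positive_elt (corner (star V * X * V)).

Lemma form_positive_herm X : form_positive X -> star X = X.
Proof. by case. Qed.

Lemma form_positiveD X Y : form_positive X -> form_positive Y -> form_positive (X + Y).
Proof.
move=> [XX pX] [YY pY]; split=> [|V]; first by rewrite starD XX YY.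
rewrite mulrDr mulrDl cornerD.
exact: (cone_add posA (pX V) (pY V)).
Qed.

Lemma corner_starM V : positive_elt (corner (star V * V)).
Proof.
have [a [b [c [d ->]]]] := block2_surj V.
rewrite star_block2 mul_block2 cornerE.
by apply: (cone_add posA); exact: positive_starM.
Qed.

Lemma form_positive_starM V : form_positive (star V * V).
Proof.
split=> [|W]; first by rewrite starMr starK.
have -> : star W * (star V * V) * W = star (V * W) * (V * W).
  by rewrite starMr !mulrA.
exact: corner_starM.
Qed.

Lemma form_positive_diag p r : positive_elt p -> positive_elt r ->
  form_positive (block2 p 0 0 r).
Proof.
move=> pp pr; split.
  by rewrite star_block2 star0 (cone_herm posA pp) (cone_herm posA pr).
move=> V; have [a [b [c [d ->]]]] := block2_surj V.
rewrite corner_form !mul0r addr0 add0r !mulrA.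
by apply: (cone_add posA); exact: conjA.
Qed.

(** The corner n of V* V is at most some scalar K, so that
    v* X v + t >= v* X v + (t / K) n >= 0. *)
Lemma form_positive_closed X :
  (forall t, 0 < t -> form_positive (X + real_scalar t)) -> form_positive X.
Proof.
move=> pX; split.
  by have [] := pX 1 ltr01; rewrite starD star_scalar => /addIr.
move=> V; apply: (cone_closed posA) => t t0.
have [K K0 pK] := cone_bounded posA (cone_herm posA (corner_starM V)).
have [_ /(_ V)] := pX _ (divr_gt0 t0 K0).
have -> : star V * (X + real_scalar (t / K)) * V =
    star V * X * V + real_scalar (t / K) * (star V * V).
  by rewrite mulrDr mulrDl -scalarC mulrA.
rewrite cornerD corner_scalar => pXV.
have -> : corner (star V * X * V) + real_scalar t =
    (corner (star V * X * V) + real_scalar (t / K) * corner (star V * V)) +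
    real_scalar (t / K) * (real_scalar K - corner (star V * V)).
  by rewrite -addrA -mulrDr [_ + (real_scalar K - _)]addrC subrK -scalarMs divfK ?gt_eqF.
apply: (cone_add posA) => //; apply: (cone_scale posA) => //.
by rewrite divr_ge0 ?ltW.
Qed.

Lemma form_positive_bounded X : star X = X ->
  exists2 t, 0 < t & form_positive (real_scalar t - X).
Proof.
have [p [q [q' [r ->]]]] := block2_surj X; rewrite star_block2.
move=> /block2_inj[pp _ <- rr].
have [K1 K10 pK1] := cone_bounded posA pp.
have [K2 K20 pK2] := cone_bounded posA rr.
have [K3 K30 pK3] := cone_bounded posA (cone_herm posA (positive_starM q)).
have K0 : 0 < K1 + 1 + (K2 + K3) by rewrite !addr_gt0.
exists (K1 + 1 + (K2 + K3)) => //.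
(* completing the square with the row (1, - q) *)
have -> : real_scalar (K1 + 1 + (K2 + K3)) - block2 p q (star q) r =
    (block2 (real_scalar K1 - p) 0 0 (real_scalar K2 - r) +
     block2 (real_scalar (K2 + K3)) 0 0 (real_scalar K3 - star q * q)) +
    (star (block2 1 (- q) 0 0 : M2) * block2 1 (- q) 0 0 +
     block2 0 0 0 (real_scalar (K1 + 1))).
  rewrite star_block2 mul_block2 scalar_block2 opp_block2 !add_block2.
  rewrite !(star0, star1, mulr0, mul0r, mul1r, mulr1, addr0, add0r) starN mulrNN.
  congr block2; rewrite ?sub0r//.
    by rewrite !scalarD scalar1 [LHS]addrAC (addrAC _ 1) [LHS]addrAC.
  rewrite [RHS]addrA -(addrA _ (real_scalar K3 - _)) subrK [_ - r + _]addrAC.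
  by rewrite !scalarD [RHS]addrC -!addrA.
apply: form_positiveD; apply: form_positiveD.
- exact: form_positive_diag.
- by apply: form_positive_diag => //; apply: (cone_scalar posA); rewrite addr_ge0 ?ltW.
- exact: form_positive_starM.
- apply: form_positive_diag; first by rewrite -scalar0; exact: (cone_scalar posA).
  by apply: (cone_scalar posA); rewrite addr_ge0 ?ltW.
Qed.

(** Schur complement: with X = [[p, q], [q*, r]] bounded below, p is invertible, the
    form of X at (- p^-1 q, 1) is s = r - q* p^-1 q, and X is the product of
    triangular matrices with diag (p, s). *)
Lemma form_positive_inv X t : 0 < t -> form_positive (X - real_scalar t) ->
  invertible X.
Proof.
have [p [q [q' [r ->]]]] := block2_surj X.
move=> t0; rewrite scalar_block2 opp_block2 add_block2 oppr0 !addr0 => -[].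
rewrite star_block2 => /block2_inj[pp _ <- rr] pX.
have [p' [pp' p'p]] : invertible p.
  apply: (cone_inv posA t0); have := pX (block2 1 0 0 0).
  by rewrite corner_form star1 star0 mul1r mul0r !mulr0 !addr0 mulr1.
pose s := r - star q * p' * q.
have [s' [ss' s's]] : invertible s.
  apply: (cone_inv posA t0); have := pX (block2 (- (p' * q)) 0 1 0).
  rewrite corner_form; set v := - (p' * q).
  have -> : (p - real_scalar t) * v + q * 1 = - (real_scalar t * v).
    by rewrite mulr1 mulrBl {1}/v mulrN mulrA pp' mul1r addrAC addNr sub0r.
  have -> : star q * v + (r - real_scalar t) * 1 = s - real_scalar t.
    by rewrite mulr1 /v mulrN mulrA addrC addrAC.
  rewrite star1 mul1r mulrN mulrA -scalarC -mulrA addrC => pv.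
  rewrite -[s - _](subrK (real_scalar t * (star v * v))).
  apply: (cone_add posA pv); apply: (cone_scale posA); first exact: ltW.
  exact: positive_starM.
have -> : block2 p q (star q) r =
    (block2 1 0 (star q * p') 1 : M2) * block2 p 0 0 s * block2 1 (p' * q) 0 1.
  rewrite !mul_block2 !(mulr0, mul0r, mul1r, mulr1, addr0, add0r).
  congr block2; first by rewrite mulrA pp' mul1r.
    by rewrite -mulrA p'p mulr1.
  by rewrite -(mulrA (star q)) p'p mulr1 /s addrC -mulrA subrK.
apply: invertibleM; [apply: invertibleM|].
- exists (block2 1 0 (- (star q * p')) 1); split;
    rewrite mul_block2 !(mulr0, mul0r, mul1r, mulr1, addr0, add0r) one_block2.
    by rewrite subrr.
  by rewrite addNr.
- exists (block2 p' 0 0 s'); split;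
    rewrite mul_block2 !(mulr0, mul0r, addr0, add0r) one_block2.
    by rewrite pp' ss'.
  by rewrite p'p s's.
- exists (block2 1 (- (p' * q)) 0 1); split;
    rewrite mul_block2 !(mulr0, mul0r, mul1r, mulr1, addr0, add0r) one_block2.
    by rewrite addNr.
  by rewrite subrr.
Qed.

Lemma form_positive_cone : spectral_cone form_positive.
Proof.
split.
- exact: form_positive_herm.
- exact: form_positiveD.
- by rewrite -[1]mulr1 -{1}star1; exact: form_positive_starM.
- move=> X H [XX pX] HH _; split; first by rewrite !starMr XX HH mulrA.
  move=> V; have -> : star V * (H * X * H) * V = star (H * V) * X * (H * V).
    by rewrite starMr HH !mulrA.
  exact: pX.
- exact: form_positive_bounded.
- exact: form_positive_closed.
- exact: form_positive_inv.
Qed.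

Lemma positive_block2 a b c d :
  positive_elt (block2 a b c d) <->
  [/\ star a = a, star b = c, star d = d &
     forall v w, positive_elt (star v * (a * v + b * w) + star w * (c * v + d * w))].
Proof.
rewrite -(spectral_coneE form_positive_cone); split.
  move=> [+ pX]; rewrite star_block2 => /block2_inj[aa _ bc dd]; split=> // v w.
  by have := pX (block2 v 0 w 0); rewrite corner_form.
move=> [aa bc dd pX]; split; first by rewrite star_block2 aa bc dd -bc starK.
by move=> V; have [x [y [z [u ->]]]] := block2_surj V; rewrite corner_form.
Qed.

End MatrixPositivity.

(** * Norms, sequences and C*-algebras *)

Section NormedSequences.
Variables (R : realType) (V : completeNormedModType R[i]).
Implicit Types (x y : V) (u : nat -> V).

Definition rnorm (x : V) : R := complex.Re `|x|.
Arguments rnorm : simpl never.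

Lemma rnormE x : `|x| = (rnorm x)%:C.
Proof. by rewrite /rnorm RRe_real// normr_real. Qed.

Lemma rnorm_ge0 x : 0 <= rnorm x.
Proof. by rewrite -ler0c -rnormE. Qed.

Lemma rnorm_triangle x y : rnorm (x + y) <= rnorm x + rnorm y.
Proof. by rewrite -lecR rmorphD /= -!rnormE ler_normD. Qed.

Lemma rnormN x : rnorm (- x) = rnorm x.
Proof. by rewrite /rnorm normrN. Qed.

Lemma rnormB x y : rnorm (x - y) = rnorm (y - x).
Proof. by rewrite -rnormN opprB. Qed.

Lemma rnormZ (l : R[i]) s x : `|l| = s%:C -> rnorm (l *: x) = s * rnorm x.
Proof.
by move=> ls; apply: complexI; rewrite -rnormE normrZ ls rmorphM /= -rnormE.
Qed.

Lemma rnorm_eq0 x : rnorm x <= 0 -> x = 0.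
Proof. by rewrite -lecR -rnormE normr_le0 => /eqP. Qed.

Lemma posc_real (e : R[i]) : 0 < e -> exists2 d : R, 0 < d & e = d%:C.
Proof.
case: e => a b; rewrite ltcE /= => /andP[/eqP -> a0].
by exists a.
Qed.

Lemma cvgn_rnormP u x : u @ \oo --> x <->
  forall e : R, 0 < e -> exists N, forall n, (N <= n)%N -> rnorm (u n - x) <= e.
Proof.
split.
  move=> /cvgrPdistC_le ux e e0; have ec0 : 0 < e%:C by rewrite ltcR.
  have [N _ Nu] := ux _ ec0; exists N => n Nn.
  by rewrite -lecR -rnormE; exact: Nu.
move=> ux; apply/cvgrPdistC_le => _ /posc_real [e e0 ->].
by have [N Nu] := ux _ e0; exists N => // n /= Nn; rewrite rnormE lecR; exact: Nu.
Qed.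

Lemma cvgn_cauchy u :
  (forall e : R, 0 < e -> exists N, forall n, (N <= n)%N -> rnorm (u n - u N) < e) ->
  exists x, u @ \oo --> x.
Proof.
move=> uC; suff /cvg_ex [x ux] : cvg (u @ \oo) by exists x.
apply: cauchy_cvg; apply: cauchy_exP => _ /posc_real [e e0 ->].
have [N Nu] := uC _ e0; exists (u N); exists N => // n /= Nn.
by rewrite -ball_normE /= distrC rnormE ltcR; exact: Nu.
Qed.

Lemma cvgn_majorized u (r : nat -> R) M :
  (forall n, rnorm (u n.+1 - u n) <= r n.+1 - r n) -> (forall n, r n <= M) ->
  exists x, u @ \oo --> x.
Proof.
move=> ur rM.
have umn n k : rnorm (u (n + k)%N - u n) <= r (n + k)%N - r n.
  elim: k => [|k IH]; first by rewrite addn0 !subrr /rnorm normr0.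
  rewrite addnS -(subrK (u (n + k)%N) (u _)) -addrA.
  apply: (le_trans (rnorm_triangle _ _)); apply: (le_trans (lerD (ur _) IH)).
  by rewrite addrA subrK.
have rle n k : r n <= r (n + k)%N.
  by rewrite -subr_ge0; exact: le_trans (rnorm_ge0 _) (umn n k).
have supr : has_sup (range r) by split; [exists (r 0%N), 0%N | exists M => _ [n _ <-]].
apply: cvgn_cauchy => e e0; have [_ [N _ <-] rN] := sup_adherent e0 supr.
exists N => n Nn; rewrite -(subnKC Nn); apply: (le_lt_trans (umn _ _)).
rewrite ltrBlDr -ltrBlDl (le_lt_trans _ rN)// lerB//.
by apply: (sup_upper_bound supr); exists (N + (n - N))%N.
Qed.

Lemma cvgn_sqr_majorized u (r : nat -> R) M :
  (forall n k, rnorm (u (n + k)%N - u n) ^+ 2 <= r (n + k)%N - r n) ->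
  (forall n, r n <= M) -> exists x, u @ \oo --> x.
Proof.
move=> ur rM.
have supr : has_sup (range r) by split; [exists (r 0%N), 0%N | exists M => _ [n _ <-]].
apply: cvgn_cauchy => e e0; have e20 : 0 < e ^+ 2 by rewrite exprn_gt0.
have [_ [N _ <-] rN] := sup_adherent e20 supr.
exists N => n Nn; rewrite -(ltr_pXn2r (n := 2)) ?nnegrE ?rnorm_ge0 ?ltW//.
rewrite -(subnKC Nn); apply: (le_lt_trans (ur _ _)).
rewrite ltrBlDr -ltrBlDl (le_lt_trans _ rN)// lerB//.
by apply: (sup_upper_bound supr); exists (N + (n - N))%N.
Qed.

Lemma cvgn_rnorm_le u x y c : u @ \oo --> x ->
  (forall n, rnorm (u n - y) <= c) -> rnorm (x - y) <= c.
Proof.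
move=> /cvgn_rnormP ux uc; apply/ler_addgt0Pr => e e0; have [N Nu] := ux _ e0.
rewrite -(subrK (u N) x) -addrA addrC; apply: (le_trans (rnorm_triangle _ _)).
by apply: lerD => //; rewrite rnormB; exact: Nu.
Qed.

End NormedSequences.
Arguments rnorm : simpl never.

Section CstarInstance.
Variables (R : realType) (A : cstarAlgType R).
Implicit Types (a b : A) (c d : R).

Lemma rnormM a b : rnorm (a * b) <= rnorm a * rnorm b.
Proof. by rewrite -lecR rmorphM /= -!rnormE; exact: cstar_normM. Qed.

Lemma rnorm_cstar a : rnorm (star a * a) = rnorm a ^+ 2.
Proof. by apply: complexI; rewrite rmorphXn /= -!rnormE; exact: cstar_identity. Qed.

Lemma rnorm_star_le a : rnorm a <= rnorm (star a).
Proof.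
have [->|a0] := eqVneq (rnorm a) 0; first exact: rnorm_ge0.
have a_gt0 : 0 < rnorm a by rewrite lt_def a0 rnorm_ge0.
by rewrite -(ler_pM2r a_gt0) -expr2 -rnorm_cstar rnormM.
Qed.

Lemma cstarAlg_bound : cstar_bound (fun a c => rnorm a <= c).
Proof.
split.
- by move=> a c; exact/le_trans/rnorm_ge0.
- by move=> a c d; exact: le_trans.
- by move=> a; exists (rnorm a).
- have : rnorm (1 : A) = rnorm (1 : A) ^+ 2.
    by rewrite -rnorm_cstar star1 mulr1.
  move=> e; have [->|n0] := eqVneq (rnorm (1 : A)) 0; first exact: ler01.
  by rewrite -[leLHS](mulfK n0) -expr2 -e mulfV.
- move=> a b c d ac bd; apply: (le_trans (rnorm_triangle _ _)); exact: lerD.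
- move=> a b c d ac bd; apply: (le_trans (rnormM _ _)).
  by apply: ler_pM => //; exact: rnorm_ge0.
- move=> l s a c ls ac; rewrite (rnormZ _ ls) ler_wpM2l//.
  by rewrite -ler0c -ls.
- by move=> a c; apply: le_trans; rewrite -{2}[a]starK; exact: rnorm_star_le.
- move=> a c c0; rewrite [leLHS]rnorm_cstar ler_pXn2r ?nnegrE//.
  exact: rnorm_ge0.
- by move=> a c ac; apply/ler_addgt0Pr.
- by move=> a; exact: rnorm_eq0.
- move=> u r M ur rM; have [l /cvgn_rnormP ul] := cvgn_majorized ur rM.
  by exists l.
Qed.

End CstarInstance.

(** * Von Neumann algebras *)

Section HilbertSpace.
Variables (R : realType) (H : hilbertType R).
Implicit Types x y : H.

Lemma inner_rnorm x : inner x x = (rnorm x ^+ 2)%:C.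
Proof. by rewrite inner_norm rnormE rmorphXn. Qed.

Lemma innerBl x y z : inner (x - y) z = inner x z - inner y z.
Proof. by rewrite linearBl. Qed.

Lemma innerBr x y z : inner x (y - z) = inner x y - inner x z.
Proof. by rewrite linearBr. Qed.

Lemma innerZl (l : R[i]) x y : inner (l *: x) y = l * inner x y.
Proof. by rewrite linearZl. Qed.

Lemma innerZr (t : R) x y : inner x (t%:C *: y) = t%:C * inner x y.
Proof. by rewrite linearZr /= [Num.conj _]conjc_real. Qed.

(** Expand the squared norm of |y| x - |x| y. *)
Lemma inner_real_le x y s : inner x y = s%:C -> s <= rnorm x * rnorm y.
Proof.
move=> xy; have yx : inner y x = s%:C by rewrite inner_conj xy [LHS]conjc_real.
have [x0|x0] := eqVneq (rnorm x) 0.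
  have xE : x = 0 by apply: rnorm_eq0; rewrite x0.
  have : s%:C = 0 by rewrite -xy xE linear0l.
  by move=> [->]; rewrite x0 mul0r.
have [y0|y0] := eqVneq (rnorm y) 0.
  have yE : y = 0 by apply: rnorm_eq0; rewrite y0.
  have : s%:C = 0 by rewrite -xy yE linear0r.
  by move=> [->]; rewrite y0 mulr0.
set a := rnorm x; set b := rnorm y.
have ab0 : 0 < a * b by rewrite mulr_gt0 // lt_def ?x0 ?y0 rnorm_ge0.
have : 0 <= (rnorm (b%:C *: x - a%:C *: y) ^+ 2)%:C by rewrite ler0c sqr_ge0.
rewrite -inner_rnorm innerBl !innerBr !innerZl !innerZr !inner_rnorm xy yx -/a -/b.
rewrite -!(rmorphM, rmorphB) ler0c => h.
by rewrite -(ler_pM2l ab0); lra.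
Qed.

End HilbertSpace.

Section VonNeumannBound.
Variables (R : realType) (H : hilbertType R) (M : vonNeumannAlg H).
(* Sums and products of operators are those of the *-algebra M. *)
Local Notation W := (StarAlgebra.sort (vn_carrier M : starAlgType R)).
Implicit Types (S T : W) (x y : H).

Lemma vn_in T : vn_set M (sval T).
Proof. exact: set_mem (svalP T). Qed.

Lemma vn_lin T : linear (sval T).
Proof. by have [] := vn_bounded (vn_in T). Qed.

Lemma vn_ext S T : sval S =1 sval T -> S = T.
Proof. by move=> /funext; exact: val_inj. Qed.

Lemma opD T x y : sval T (x + y) = sval T x + sval T y.
Proof. by have := vn_lin T 1 x y; rewrite !scale1r. Qed.

Lemma op0 T : sval T 0 = 0.
Proof. by apply: (addrI (sval T 0)); rewrite -opD !addr0. Qed.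

Lemma opZ T (l : R[i]) x : sval T (l *: x) = l *: sval T x.
Proof. by have := vn_lin T l x 0; rewrite op0 !addr0. Qed.

Lemma addopE S T x : sval (S + T) x = sval S x + sval T x. Proof. by []. Qed.

Lemma subopE S T x : sval (S - T) x = sval S x - sval T x. Proof. by []. Qed.

Lemma mulopE S T x : sval (S * T) x = sval S (sval T x). Proof. by []. Qed.

Lemma oneopE x : sval (1 : W) x = x. Proof. by []. Qed.

Lemma scalaropE t x : sval (real_scalar t : W) x = t%:C *: x. Proof. by []. Qed.

Lemma staropE T x y : inner (sval T x) y = inner x (sval (star T) y).
Proof. exact: vn_starfP. Qed.

Lemma staropE' T x y : inner (sval (star T) x) y = inner x (sval T y).
Proof. by rewrite staropE starK. Qed.

Definition op_bound T (c : R) :=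
  0 <= c /\ forall x, rnorm (sval T x) <= c * rnorm x.

Lemma op_bound_ex T : exists c, op_bound T c.
Proof.
have [_ cT] := vn_bounded (vn_in T).
have /cvgrPdistC_le/(_ 1 ltr01) := cT 0.
rewrite op0 => /nbhs_ballP[_ /posc_real[d d0 ->]] dT.
exists (2 / d); split=> [|x]; first by rewrite divr_ge0 ?ltW.
have [x0|x0] := eqVneq (rnorm x) 0.
  by rewrite (rnorm_eq0 (_ : rnorm x <= 0)) ?x0// op0 /rnorm normr0 mulr0.
have x_gt0 : 0 < rnorm x by rewrite lt_def x0 rnorm_ge0.
pose s := d / 2 / rnorm x.
have s0 : 0 < s by rewrite !divr_gt0.
have ns : `|s%:C| = s%:C :> R[i] by rewrite ger0_norm// ler0c ltW.
have : rnorm (sval T (s%:C *: x)) <= 1.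
  have := dT (s%:C *: x); rewrite /= subr0 rnormE lecR; apply.
  rewrite -ball_normE /= sub0r normrN rnormE ltcR (rnormZ _ ns).
  by rewrite divfK// ltr_pdivrMr// ltr_pMr// ltr1n.
rewrite opZ (rnormZ _ ns) mulrC -ler_pdivlMr// => /le_trans; apply.
by rewrite div1r /s !invfM !invrK mulrAC mulrC mulrA.
Qed.

(** Closedness in the strong operator topology, for sequences: by uniform
    boundedness the pointwise limit is again a bounded operator. *)
Lemma strong_limit (T : nat -> W) (f : H -> H) c : (forall n, op_bound (T n) c) ->
  (forall x, (fun n => sval (T n) x) @ \oo --> f x) -> exists S : W, sval S = f.
Proof.
move=> Tc Tf; have c0 := proj1 (Tc 0%N).
have f_lin : linear f.
  move=> l x y; apply: (cvg_unique (@norm_hausdorff _ H) (Tf _)).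
  have -> : (fun n => sval (T n) (l *: x + y)) =
      (fun n => l *: sval (T n) x + sval (T n) y).
    by apply/funext => n; rewrite opD opZ.
  by apply: cvgD (Tf y); apply: cvgZr; exact: Tf.
have f_bnd x y : rnorm (f x - f y) <= c * rnorm (x - y).
  have -> : f x - f y = f (x - y) - 0.
    by rewrite subr0 -scaleN1r addrC -f_lin scaleN1r addrC.
  apply: (cvgn_rnorm_le (Tf (x - y))) => n; rewrite subr0.
  exact: (proj2 (Tc n)).
have f_cont : continuous f.
  move=> x; apply/cvgrPdistC_le => _ /posc_real[e e0 ->].
  have d0 : 0 < e / (c + 1) by rewrite divr_gt0// ltr_wpDl.
  apply/nbhs_ballP; exists (e / (c + 1))%:C => /=; first by rewrite ltcR.
  move=> y; rewrite -ball_normE /= rnormE ltcR => yx.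
  rewrite rnormE lecR (le_trans (f_bnd _ _))// rnormB.
  have := rnorm_ge0 (x - y); rewrite ltr_pdivlMr ?ltr_wpDl// in yx.
  by move=> ?; nra.
have Mf : vn_set M f.
  apply: vn_closed => // B Bf.
  have /(pointwise_cvgP _ _) : forall x, (fun g : H -> H => g x) @ ((fun n => sval (T n)) @ \oo) --> f x.
    exact: Tf.
  move=> /(_ _ Bf) [N _ /(_ N (leqnn N)) BN].
  by exists (sval (T N)); split => //; exact: vn_in.
by exists (exist _ f (mem_set Mf)).
Qed.

Lemma vn_cstar_bound : cstar_bound op_bound.
Proof.
split.
- by move=> T c [].
- move=> T c d [c0 Tc] cd; split=> [|x]; first exact: le_trans cd.
  by apply: (le_trans (Tc x)); rewrite ler_wpM2r ?rnorm_ge0.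
- exact: op_bound_ex.
- by split=> [|x]; [exact: ler01|rewrite mul1r oneopE].
- move=> S T c d [c0 Sc] [d0 Td]; split=> [|x]; first exact: addr_ge0.
  rewrite addopE mulrDl; apply: (le_trans (rnorm_triangle _ _)); exact: lerD.
- move=> S T c d [c0 Sc] [d0 Td]; split=> [|x]; first exact: mulr_ge0.
  by rewrite mulopE -mulrA; apply: (le_trans (Sc _)); rewrite ler_wpM2l.
- move=> l s T c ls [c0 Tc]; have s0 : 0 <= s by rewrite -ler0c -ls.
  split=> [|x]; first exact: mulr_ge0.
  have -> : sval (l *: T) x = l *: sval T x by [].
  by rewrite (rnormZ _ ls) -mulrA ler_wpM2l.
(* |T* x| ^ 2 = <T T* x, x> <= c |T* x| |x| *)
- move=> T c [c0 Tc]; split=> // x; set y := sval (star T) x.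
  have [->|y0] := eqVneq (rnorm y) 0; first by rewrite mulr_ge0 ?rnorm_ge0.
  have y_gt0 : 0 < rnorm y by rewrite lt_def y0 rnorm_ge0.
  rewrite -(ler_pM2l y_gt0) -expr2 (le_trans (y := rnorm (sval T y) * rnorm x))//.
    by apply: inner_real_le; rewrite staropE inner_rnorm.
  by rewrite mulrCA mulrA ler_wpM2r ?rnorm_ge0.
(* |T x| ^ 2 = <T* T x, x> <= c ^ 2 |x| ^ 2 *)
- move=> T c c0 [_ Tc]; split=> // x.
  rewrite -(ler_pXn2r (n := 2)) ?nnegrE ?rnorm_ge0 ?mulr_ge0 ?rnorm_ge0//.
  apply: (le_trans (y := rnorm (sval (star T * T) x) * rnorm x)).
    by apply: inner_real_le; rewrite mulopE staropE' inner_rnorm.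
  by rewrite exprMn [rnorm x ^+ 2]expr2 mulrA ler_wpM2r ?rnorm_ge0.
- move=> T c Tc; have c0 : 0 <= c.
    by apply/ler_addgt0Pr => e /Tc [].
  split=> // x; apply/ler_addgt0Pr => e e0.
  have x1 : 0 < rnorm x + 1 by rewrite ltr_wpDl ?rnorm_ge0.
  have [_ /(_ x)] := Tc _ (divr_gt0 e0 x1).
  rewrite mulrDl => /le_trans; apply; rewrite lerD2l.
  by rewrite mulrAC ler_pdivrMr// ler_wpM2l ?lerDl// ltW.
- move=> T [_ T0]; apply: vn_ext => x; apply: rnorm_eq0.
  by have := T0 x; rewrite mul0r.
(* the sequence converges pointwise, and uniformly on the unit ball *)
- move=> u r m ur rm.
  have [c0 [c00 uc0]] := op_bound_ex (u 0%N).
  have urx x n : rnorm (sval (u n.+1) x - sval (u n) x) <=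
      r n.+1 * rnorm x - r n * rnorm x.
    by rewrite -mulrBl -subopE; exact: (proj2 (ur n)).
  have rmx x n : r n * rnorm x <= m * rnorm x by rewrite ler_wpM2r ?rnorm_ge0.
  have rS n : r n <= r n.+1 by rewrite -subr_ge0; exact: (proj1 (ur n)).
  have rle n k : r n <= r (n + k)%N.
    by elim: k => [|k IH]; rewrite ?addn0// addnS (le_trans IH).
  have umn x n k : rnorm (sval (u (n + k)%N) x - sval (u n) x) <=
      (r (n + k)%N - r n) * rnorm x.
    elim: k => [|k IH]; first by rewrite addn0 !subrr mul0r /rnorm normr0.
    rewrite addnS -(subrK (sval (u (n + k)%N) x) (sval (u _) x)) -addrA.
    apply: (le_trans (rnorm_triangle _ _)); apply: (le_trans (lerD (urx _ _) IH)).
    by rewrite -mulrBl -mulrDl addrA subrK.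
  have [f uf] : exists f : H -> H, forall x, (fun n => sval (u n) x) @ \oo --> f x.
    exists (fun x => projT1 (cid (cvgn_majorized (urx x) (rmx x)))) => x.
    by case: cid.
  have [S Sf] : exists S : W, sval S = f.
    apply: (strong_limit (c := (m - r 0%N) + c0)) uf => n; split=> [|x].
      by rewrite addr_ge0// subr_ge0.
    rewrite -(subrK (sval (u 0%N) x) (sval (u n) x)) mulrDl.
    apply: (le_trans (rnorm_triangle _ _)); apply: lerD => //.
    have := umn x 0%N n; rewrite add0n => /le_trans; apply.
    by rewrite ler_wpM2r ?rnorm_ge0// lerB.
  exists S => e e0.
  have supr : has_sup (range r) by split; [exists (r 0%N), 0%N | exists m => _ [n _ <-]].
  have [_ [N _ <-] rN] := sup_adherent e0 supr.
  exists N => n Nn; split=> [|x]; first exact: ltW.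
  rewrite subopE Sf rnormB.
  have ufn : (fun k => sval (u (k + n)%N) x) @ \oo --> f x.
    by rewrite (cvg_shiftn n (fun k => sval (u k) x)).
  apply: (cvgn_rnorm_le ufn) => k; rewrite addnC.
  apply: (le_trans (umn _ _ _)); rewrite ler_wpM2r ?rnorm_ge0//.
  rewrite lerBlDl (le_trans (y := sup (range r)))//.
    by apply: (sup_upper_bound supr); exists (n + k)%N.
  apply/ltW; rewrite -ltrBlDr; apply: (lt_le_trans rN).
  by rewrite -(subnKC Nn).
Qed.

End VonNeumannBound.

(** * Lieb maps and 2-positive maps *)

Section LiebOfTwoPositive.
Variables (R : realType) (A B : starAlgType R).
Variables (bndA : A -> R -> Prop) (bndB : B -> R -> Prop).
Hypotheses (hA : cstar_bound bndA) (hB : cstar_bound bndB).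
Variable Phi : A -> B.

Lemma ampliation_block2 a b c d :
  ampliation Phi (block2 a b c d) = block2 (Phi a) (Phi b) (Phi c) (Phi d).
Proof. by apply: block2P; rewrite !mxE. Qed.

Let block2_posA a b c d :=
  positive_block2 (positive_elt_cone hA) (positive_elt_conj hA) a b c d.
Let block2_posB a b c d :=
  positive_block2 (positive_elt_cone hB) (positive_elt_conj hB) a b c d.

(** Cauchy-Schwarz comes from [a b]* [a b] >= 0; monotonicity from
    [[a, b], [b, b]] = diag (a - b, 0) + b [[1, 1], [1, 1]] >= 0, whose image is
    evaluated at the vector (1, - 1). *)
Lemma two_positive_Lieb : n_positive 2 Phi -> Lieb_map Phi.
Proof.
move=> Phi2; split=> [a b bp abp|a b].
  have bb : star b = b by have [] := bp.
  have aa : star a = a by rewrite -(subrK b a) starD bb (proj1 abp).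
  have X : positive_elt (block2 a b b b).
    apply/block2_posA; split=> // v w.
    have -> : star v * (a * v + b * w) + star w * (b * v + b * w) =
        star v * (a - b) * v + star (v + w) * b * (v + w).
      have -> : a * v + b * w = (a - b) * v + b * (v + w).
        by rewrite mulrBl mulrDr addrA subrK.
      by rewrite -mulrDr [star v * _]mulrDr -addrA -mulrDl -starD !mulrA.
    by apply: (cone_add (positive_elt_cone hA)); apply: (positive_elt_conj hA).
  move: (Phi2 _ X); rewrite ampliation_block2 => /block2_posB[_ _ _ /(_ 1 (- 1))].
  by rewrite starN star1 mul1r !mulr1 !mulrN !mulr1 subrr mulr0 addr0.
have X : positive_elt (block2 (star a * a) (star a * b) (star b * a) (star b * b)).
  apply/block2_posA; rewrite !starMr !starK; split=> // v w.
  have -> : star v * (star a * a * v + star a * b * w) +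
      star w * (star b * a * v + star b * b * w) = star (a * v + b * w) * (a * v + b * w).
    by rewrite starD !starMr mulrDl !mulrDr !mulrA.
  exact: (positive_starM (positive_elt_cone hA) (positive_elt_conj hA)).
move: (Phi2 _ X); rewrite ampliation_block2 => PX.
by have [_ -> _ _] := (iffLR (block2_posB _ _ _ _) PX).
Qed.

End LiebOfTwoPositive.

Section SchurBound.
Variables (R : realType) (A : starAlgType R) (bnd : A -> R -> Prop).
Hypothesis hA : cstar_bound bnd.
Implicit Types a b d g h : A.

(** With h = (a + t)^-1 b, X = h* a h and Y = t h* h, the form of the matrix at
    (- h, 1) is d - X - 2 Y. *)
Lemma schur_bound a b d h t : positive_elt (block2 a b (star b) d) -> 0 <= t ->
  (a + real_scalar t) * h = b ->
  positive_elt (d - star h * a * h) /\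
  positive_elt (d - real_scalar t * (star h * h)).
Proof.
move=> Xp t0 hb; have posA := positive_elt_cone hA; have conjA := positive_elt_conj hA.
have [aa _ dd form] := iffLR (positive_block2 posA conjA _ _ _ _) Xp.
have ap : positive_elt a.
  have := form 1 0; rewrite star1 star0 mul0r !mulr0 !addr0 mul1r mulr1.
  by [].
set X := star h * a * h; set Y := real_scalar t * (star h * h).
have Xp' : positive_elt X by exact: conjA.
have Yp : positive_elt Y.
  by apply: (cone_scale posA) => //; exact: positive_starM.
have Q : positive_elt (d - (X + Y) - Y).
  have := form (- h) 1; rewrite star1 mul1r !mulr1 starN !mulNr !mulrN.
  have -> : - (a * h) + b = real_scalar t * h.
    by rewrite -hb mulrDl addrA addNr add0r.
  have -> : star b * h = X + Y.
    by rewrite -hb starMr starD star_scalar aa mulrDr mulrDl /Y mulrA -scalarC.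
  by rewrite mulrA -scalarC -mulrA -/Y addrC [_ + d]addrC.
split.
  have -> : d - X = (d - (X + Y) - Y) + (Y + Y).
    by rewrite addrA subrK opprD addrA subrK.
  by apply: (cone_add posA) => //; exact: (cone_add posA).
have -> : d - Y = (d - (X + Y) - Y) + (X + Y).
  by rewrite addrAC subrK.
by apply: (cone_add posA) => //; exact: (cone_add posA).
Qed.

Lemma star_sqr_increment a b :
  star (a + b) * (a + b) - star a * a - star b * b = star a * b + star b * a.
Proof.
rewrite starD mulrDl !mulrDr addrA [LHS]addrAC addrK.
by rewrite -(addrA (star a * a)) addrC addKr.
Qed.

(** Write y = s h, y' = s h' and z = y - y'.  The resolvent identity gives
    z = (t' - t) g y', so that y'* z = z* y' >= 0, and
    y* y - y'* y' - z* z = y'* z + z* y'. *)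
Lemma resolvent_increment a b s g h h' t t' : positive_elt a -> star s = s ->
  s * a = a * s -> 0 < t -> t <= t' ->
  (a + real_scalar t) * g = 1 -> g * (a + real_scalar t) = 1 ->
  (a + real_scalar t) * h = b -> (a + real_scalar t') * h' = b ->
  positive_elt (star (s * h) * (s * h) - star (s * h') * (s * h') -
    star (s * h - s * h') * (s * h - s * h')).
Proof.
move=> ap ss sa t0 tt' ag ga hb hb'.
have posA := positive_elt_cone hA; have conjA := positive_elt_conj hA.
have aa := cone_herm posA ap; set r := a + real_scalar t in ag ga hb.
have rr : star r = r by rewrite starD star_scalar aa.
have gg : star g = g := inv_herm rr ag ga.
have gp : positive_elt g.
  have -> : g = star g * r * g by rewrite -mulrA ag mulr1 gg.
  apply: conjA; apply: (cone_add posA) => //.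
  by apply: (cone_scalar posA); exact: ltW.
have gs : g * s = s * g.
  by apply: (inv_comm ag ga); rewrite mulrDl mulrDr sa scalarC.
set y' := s * h'; set z := s * h - y'.
have zE : z = real_scalar (t' - t) * (g * y').
  rewrite /z /y' -mulrBr (mulrA g) gs -mulrA mulrA scalarC -mulrA; congr (s * _).
  have -> : h = g * b by rewrite -hb mulrA ga mul1r.
  have -> : h' = g * (r * h') by rewrite mulrA ga mul1r.
  rewrite -mulrBr [RHS]mulrA scalarC -mulrA; congr (g * _).
  rewrite [g * (r * h')]mulrA ga mul1r -hb' /r scalarD scalarN mulrBl !mulrDl.
  by rewrite opprD addrACA subrr add0r.
have -> : s * h = y' + z by rewrite addrC subrK.
have -> : star (y' + z) * (y' + z) - star y' * y' - star z * z =
    star y' * z + star z * y'.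
  exact: star_sqr_increment.
have p : positive_elt (star y' * z).
  rewrite zE mulrA -scalarC -mulrA (mulrA (star y')).
  by apply: (cone_scale posA); [rewrite subr_ge0|exact: conjA].
apply: (cone_add posA) => //; suff <- : star y' * z = star z * y' by [].
by rewrite -[LHS](cone_herm posA p) starMr starK.
Qed.

End SchurBound.

Section VonNeumannPositivity.
Variables (R : realType) (H : hilbertType R) (M : vonNeumannAlg H).
Local Notation W := (StarAlgebra.sort (vn_carrier M : starAlgType R)).
Implicit Types (a b d e s S T U w : W) (x : H).

Let hW := vn_cstar_bound M.

Definition re_form T x : R := complex.Re (inner (sval T x) x).

Lemma re_formB S T x : re_form (S - T) x = re_form S x - re_form T x.
Proof. by rewrite /re_form subopE innerBl raddfB. Qed.

Lemma re_form_scalar t T x : re_form (real_scalar t * T) x = t * re_form T x.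
Proof.
rewrite /re_form mulopE scalaropE innerZl; case: (inner _ _) => p q /=.
by rewrite mul0r subr0.
Qed.

Lemma re_form_starM T x : re_form (star T * T) x = rnorm (sval T x) ^+ 2.
Proof. by rewrite /re_form mulopE staropE' inner_rnorm. Qed.

Lemma positive_starM_sqrt T : positive_elt T -> exists s, star s = s /\ T = star s * s.
Proof.
by move=> /(positive_elt_sqrt hW)[s [[ss _] sT _]]; exists s; rewrite ss sT.
Qed.

Lemma re_form_ge0 T x : positive_elt T -> 0 <= re_form T x.
Proof.
by move=> /positive_starM_sqrt[s [_ ->]]; rewrite re_form_starM sqr_ge0.
Qed.

Lemma rnorm_dominated S T x : positive_elt (star S * S - star T * T) ->
  rnorm (sval T x) <= rnorm (sval S x).
Proof.
move=> /(re_form_ge0 x); rewrite re_formB !re_form_starM subr_ge0.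
by rewrite ler_pXn2r// nnegrE rnorm_ge0.
Qed.

(** Let w be twice the negative part of T.  Then <T w x, w x> = - |s w x| ^ 2 with
    s = |T|^(1/2), so that s w = 0 and therefore w = 0. *)
Lemma re_form_positive T : star T = T -> (forall x, 0 <= re_form T x) ->
  positive_elt T.
Proof.
move=> TT T0; have [U [w [Up ww _ wTw wE]]] := negative_part hW TT.
rewrite (norm_positiveE hW) in Up.
have [s [ss sU]] := positive_starM_sqrt Up.
have wUw : w * U * w = star (s * w) * (s * w) by rewrite sU starMr ww !mulrA.
suff sw : s * w = 0 by rewrite wE// wUw sw mulr0.
apply: vn_ext => x; apply: rnorm_eq0.
suff : rnorm (sval (s * w) x) ^+ 2 <= 0.
  by rewrite exprn_even_le0//= => /eqP ->.
rewrite -re_form_starM -wUw -oppr_ge0.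
have -> : - re_form (w * U * w) x = re_form T (sval w x).
  have -> : re_form T (sval w x) = re_form (w * T * w) x.
    by rewrite /re_form !mulopE (staropE w) ww.
  by rewrite wTw -[- (_ * _ * _)]sub0r re_formB /re_form linear0l sub0r.
exact: T0.
Qed.

Lemma op_cvg T (u : nat -> H) x : u @ \oo --> x ->
  (fun n => sval T (u n)) @ \oo --> sval T x.
Proof.
by move=> ux; have [_ cT] := vn_bounded (vn_in T); exact: (cvg_comp _ _ ux (cT x)).
Qed.

(** This is where M has to be a von Neumann algebra: y is the strong limit of
    a^(1/2) (a + t)^-1 b as t decreases to 0, which exists because the squares
    y_t* y_t increase and are dominated by d. *)
Lemma block_factor a b d : positive_elt (block2 a b (star b) d) ->
  exists s y : W, [/\ star s * s = a, star s * y = b & positive_elt (d - star y * y)].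
Proof.
move=> Xp; have posA := positive_elt_cone hW; have conjA := positive_elt_conj hW.
have [aa _ dd form] := iffLR (positive_block2 posA conjA _ _ _ _) Xp.
have ap : positive_elt a.
  by have := form 1 0; rewrite star1 star0 mul0r !mulr0 !addr0 mul1r mulr1.
have dp : positive_elt d.
  by have := form 0 1; rewrite star1 star0 mul0r !mulr0 !add0r mul1r mulr1.
have [s [[ss _] sa sC]] := positive_elt_sqrt hW ap.
have [e [_ de]] := positive_starM_sqrt dp.
pose t n : R := n.+1%:R^-1.
have t0 n : 0 < t n by rewrite invr_gt0.
have inv n : exists g, (a + real_scalar (t n)) * g = 1 /\ g * (a + real_scalar (t n)) = 1.
  by apply: (cone_inv posA (t0 n)); rewrite addrK.
pose g n := projT1 (cid (inv n)).
have ag n : (a + real_scalar (t n)) * g n = 1 by rewrite /g; case: cid => ? [].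
have ga n : g n * (a + real_scalar (t n)) = 1 by rewrite /g; case: cid => ? [].
pose h n := g n * b; have hb n : (a + real_scalar (t n)) * h n = b.
  by rewrite mulrA ag mul1r.
pose y n := s * h n.
have yy n : star (y n) * y n = star (h n) * a * h n by rewrite starMr ss -sa !mulrA.
have ye n x : rnorm (sval (y n) x) <= rnorm (sval e x).
  apply: rnorm_dominated; rewrite yy -de.
  exact: (proj1 (schur_bound hW Xp (ltW (t0 n)) (hb n))).
have he n x : t n * rnorm (sval (h n) x) ^+ 2 <= rnorm (sval e x) ^+ 2.
  have := re_form_ge0 x (proj2 (schur_bound hW Xp (ltW (t0 n)) (hb n))).
  by rewrite de re_formB re_form_scalar !re_form_starM subr_ge0.
have inc x n k : rnorm (sval (y (n + k)%N) x - sval (y n) x) ^+ 2 <=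
    rnorm (sval (y (n + k)%N) x) ^+ 2 - rnorm (sval (y n) x) ^+ 2.
  have tnk : t (n + k)%N <= t n.
    by rewrite lef_pV2 ?posrE// ler_nat ltnS leq_addr.
  have sa' : s * a = a * s by rewrite -sa mulrA.
  have := re_form_ge0 x (resolvent_increment hW ap ss sa' (t0 _) tnk
    (ag _) (ga _) (hb _) (hb _)).
  by rewrite !re_formB !re_form_starM subopE subr_ge0.
have [f yf] : exists f : H -> H, forall x, (fun n => sval (y n) x) @ \oo --> f x.
  suff yx x : exists l : H, (fun n => sval (y n) x) @ \oo --> l.
    by exists (fun x => projT1 (cid (yx x))) => x; case: cid.
  apply: (cvgn_sqr_majorized (r := fun n => rnorm (sval (y n) x) ^+ 2)
    (M := rnorm (sval e x) ^+ 2)) => [n k|n]; first exact: inc.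
  by rewrite ler_pXn2r// nnegrE rnorm_ge0.
have [c [c0 ec]] := op_bound_ex e.
have [Y Yf] : exists Y : W, sval Y = f.
  apply: (strong_limit (c := c)) yf => n; split=> // x.
  exact: le_trans (ye n x) (ec x).
exists s, Y; split; first by rewrite ss.
  rewrite ss; apply: vn_ext => x; rewrite mulopE Yf.
  apply: (cvg_unique (@norm_hausdorff _ H) (op_cvg (T := s) (yf x))).
  apply/cvgn_rnormP => q q0; set E := rnorm (sval e x).
  have E0 : 0 < E ^+ 2 + 1 by rewrite ltr_wpDl ?sqr_ge0.
  have p0 : 0 < q ^+ 2 / (E ^+ 2 + 1) by rewrite divr_gt0// exprn_gt0.
  exists (Num.bound (q ^+ 2 / (E ^+ 2 + 1))^-1) => n Nn.
  have tn : t n <= q ^+ 2 / (E ^+ 2 + 1).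
    rewrite -[leRHS]invrK lef_pV2 ?posrE ?invr_gt0//.
    have pV0 : 0 <= (q ^+ 2 / (E ^+ 2 + 1))^-1 by rewrite invr_ge0 ltW.
    by apply/ltW/(lt_le_trans (archi_boundP pV0)); rewrite ler_nat leqW.
  (* s y_t = a (a + t)^-1 b = b - t h, and |t h x| ^ 2 <= t <d x, x> *)
  have -> : sval s (sval (y n) x) - sval b x = - ((t n)%:C *: sval (h n) x).
    have sy : s * y n = b - real_scalar (t n) * h n.
      by rewrite -(hb n) mulrDl addrK mulrA sa.
    by rewrite -mulopE sy subopE mulopE scalaropE addrC addKr.
  have nt : `|(t n)%:C| = (t n)%:C :> R[i] by rewrite ger0_norm// ler0c ltW.
  rewrite rnormN (rnormZ _ nt).
  rewrite -(ler_pXn2r (n := 2)) ?nnegrE ?mulr_ge0 ?rnorm_ge0 ?(ltW (t0 n)) ?(ltW q0)//.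
  rewrite exprMn expr2 -mulrA; apply: (le_trans (ler_wpM2l (ltW (t0 n)) (he n x))).
  rewrite -/E; move: tn; rewrite ler_pdivlMr// => tn.
  by have := t0 n; nra.
apply: re_form_positive; first by rewrite starB starMr starK (cone_herm posA dp).
move=> x; rewrite de re_formB !re_form_starM subr_ge0 ler_pXn2r ?nnegrE ?rnorm_ge0//.
rewrite -[sval Y x]subr0 Yf; apply: (cvgn_rnorm_le (yf x)) => n.
by rewrite subr0.
Qed.

End VonNeumannPositivity.

Section TwoPositiveOfLieb.
Variables (R : realType) (H : hilbertType R) (M : vonNeumannAlg H).
Variables (B : cstarAlgType R) (Phi : vn_carrier M -> B).

(** With a = s* s, b = s* y and y* y <= d, the matrix of the Cauchy-Schwarz
    condition at (s, y) differs from the image of [[a, b], [b*, d]] by the positive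
    element Phi(d) - Phi(y* y) of the diagonal. *)
Lemma Lieb_two_positive : star_map Phi -> Lieb_map Phi -> n_positive 2 Phi.
Proof.
move=> Phistar [mono cs] X Xp.
have hW := vn_cstar_bound M; have hB := cstarAlg_bound B.
have [a [b [c [d XE]]]] := block2_surj X.
rewrite {X}XE in Xp *; rewrite ampliation_block2.
have [aa bc dd _] := iffLR (positive_block2 (positive_elt_cone hW)
  (positive_elt_conj hW) _ _ _ _) Xp.
rewrite -bc in Xp *; have [s [y [sa sb dy]]] := block_factor Xp.
have yp := positive_starM (positive_elt_cone hW) (positive_elt_conj hW) y.
have dyp := mono _ _ yp dy.
have := cs s y; rewrite sa sb.
rewrite !(positive_block2 (positive_elt_cone hB) (positive_elt_conj hB)).
move=> [Paa _ Pyy form]; split => //.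
  by rewrite -Phistar dd.
move=> v w; have -> : star v * (Phi a * v + Phi b * w) + star w * (Phi (star b) * v + Phi d * w) =
    (star v * (Phi a * v + Phi b * w) + star w * (star (Phi b) * v + Phi (star y * y) * w)) +
    star w * (Phi d - Phi (star y * y)) * w.
  rewrite -[RHS]addrA -(mulrA _ (Phi d - _)) -mulrDr -addrA -mulrDl.
  by rewrite [Phi (star y * y) + _]addrC subrK Phistar.
apply: (cone_add (positive_elt_cone hB)) => //.
exact: (positive_elt_conj hB).
Qed.

End TwoPositiveOfLieb.

Theorem corollary2p5 (R : realType) :
  (forall (A B : cstarAlgType R) (Phi : A -> B),
     n_positive 2 Phi -> Lieb_map Phi) /\
  (forall (H : hilbertType R) (M : vonNeumannAlg H) (B : cstarAlgType R)
     (Phi : vn_carrier M -> B),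
     star_map Phi -> (Lieb_map Phi <-> n_positive 2 Phi)).
Proof.
split=> [A B Phi|H M B Phi Phistar].
  exact: (two_positive_Lieb (cstarAlg_bound A) (cstarAlg_bound B)).
split; first exact: Lieb_two_positive.
exact: (two_positive_Lieb (vn_cstar_bound M) (cstarAlg_bound B)).
Qed.
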